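(* Let $P$ be an irreducible probability kernel on a countable set $S$ and let $Q\leq P$ (entrywise) be a subprobability kernel on $S$ such that $Q(x,y)>0$ if and only if $P(x,y)>0$ (for $x,y\in S$), and such that $\{(x,y)\in S^2:Q(x,y)<P(x,y)\}$ is finite. Then $P$ is strongly positive recurrent if and only if $\rho(Q)<\rho(P)=1$.
   Context: A (sub)probability kernel on a countable set $S$ is a nonnegative matrix $P=(P(x,y))_{x,y\in S}$ with $\sum_yP(x,y)=1$ (resp. $\leq 1$) for all $x\in S$. A nonnegative matrix $A=(A(x,y))_{x,y\in S}$ is irreducible if for each $x,y\in S$ there is an $n\geq 1$ such that $A^n(x,y)>0$. For irreducible $A$, the spectral radius is $\rho(A):=\lim_{n\to\infty}(A^n(x,x))^{1/n}\in(0,\infty]$, where, if $A$ is periodic, $n$ ranges only through those integers for which $A^n(x,x)>0$; the limit exists and does not depend on $x\in S$. An irreducible probability kernel $P$ on $S$ is strongly positive recurrent if for some (equivalently all) $x\in S$ there is an $\varepsilon>0$ such that $\mathbb{E}^x[e^{\varepsilon\sigma_x}]<\infty$, where $\sigma_x:=\inf\{k>0:X_k=x\}$ is the first return time to $x$ of the Markov chain $(X_k)_{k\geq 0}$ with transition kernel $P$, and $\mathbb{E}^x$ denotes expectation for the chain started in $X_0=x$.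
   Formalization: The formal theorem additionally assumes that Q(x,y)<P(x,y) for at least one pair (i.e. Q≠P); for Q=P the claim fails, e.g. S a single point with P=Q=(1), where P is strongly positive recurrent but ρ(Q)=ρ(P)=1. *)

(* Defs.v *)
(* MathComp / MathComp-Analysis. *)
From HB Require Import structures.
From mathcomp Require Import all_boot all_order all_algebra.
From mathcomp Require Import all_classical all_reals all_analysis.
Set Implicit Arguments.
Unset Strict Implicit.
Unset Printing Implicit Defensive.
Import Order.TTheory GRing.Theory Num.Theory.
Import numFieldNormedType.Exports.
Local Open Scope classical_set_scope.
Local Open Scope ring_scope.

(* Real matrices indexed by a countable set S are functions S -> S -> R. *)

Definition nonneg_matrix (R : realType) (S : countType) (A : S -> S -> R) :=
  forall x y, 0 <= A x y.

Definition is_probability_kernel (R : realType) (S : countType)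
    (P : S -> S -> R) :=
  nonneg_matrix P /\
  forall x, (\esum_(y in [set: S]) (P x y)%:E = 1)%E.

Definition is_subprobability_kernel (R : realType) (S : countType)
    (P : S -> S -> R) :=
  nonneg_matrix P /\
  forall x, (\esum_(y in [set: S]) (P x y)%:E <= 1)%E.

(* Entries of powers are extended reals because, for a general nonnegative
   matrix, the sum defining a product entry may diverge. *)
Fixpoint matrix_power (R : realType) (S : countType) (A : S -> S -> R)
    (n : nat) (x y : S) : \bar R :=
  if n is m.+1 then
    (\esum_(z in [set: S]) ((A x z)%:E * matrix_power A m z y))%E
  else (x == y)%:R%:E.

Definition irreducible (R : realType) (S : countType) (A : S -> S -> R) :=
  forall x y, exists2 n, (1 <= n)%N & (0 < matrix_power A n x y)%E.

(* The limit runs only through those n with A^n(x,x) > 0, which takes care of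
   periodicity.  For irreducible nonnegative A the limit exists and is the same
   for every x; x is kept as an argument rather than chosen. *)
Definition spectral_radius (R : realType) (S : countType) (A : S -> S -> R)
    (x : S) : \bar R :=
  lim ((fun n : nat => poweR (matrix_power A n x x) (n%:R^-1)) @
       within [set n : nat | (0 < matrix_power A n x x)%E] \oo).

(* X is a Markov chain under mu with kernel P started in x.  S carries its
   discrete sigma-algebra, so measurability is tested on singletons.  The
   Markov property P(X_{n+1} = s_{n+1} | X_0 = s_0, ..., X_n = s_n)
   = P(s_n, s_{n+1}) is multiplied out by the probability of the conditioning
   event, so that null events need no separate treatment; only s 0, ..., s n.+1
   matter. *)
Definition markov_chain (R : realType) (S : countType) (P : S -> S -> R)
    (x : S) (d : measure_display) (Omega : measurableType d)
    (mu : probability Omega R) (X : nat -> Omega -> S) :=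
  [/\ forall k y, measurable [set w | X k w = y],
      mu [set w | X 0%N w = x] = 1%E &
      forall (n : nat) (s : nat -> S),
        mu [set w | forall k, (k <= n.+1)%N -> X k w = s k] =
        (mu [set w | forall k, (k <= n)%N -> X k w = s k]
         * (P (s n) (s n.+1))%:E)%E].

(* inf {k > 0 : X_k = x}, equal to +oo when the chain never returns. *)
Definition return_time (R : realType) (S : countType) (Omega : Type)
    (X : nat -> Omega -> S) (x : S) (w : Omega) : \bar R :=
  ereal_inf [set k%:R%:E | k in [set k : nat | (0 < k)%N /\ X k w = x]].

(* E^x[exp(eps * sigma_x)] < +oo, with expeR +oo = +oo.  The law of the chain
   started in x is determined by P and x, so the value of the integral does not
   depend on the realisation; requiring one to exist rules out vacuity. *)
Definition strongly_positive_recurrent (R : realType) (S : countType)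
    (P : S -> S -> R) :=
  exists (x : S) (eps : R), 0 < eps /\
  exists (d : measure_display) (Omega : measurableType d)
    (mu : probability Omega R) (X : nat -> Omega -> S),
    markov_chain P x mu X /\
    (\int[mu]_w expeR (eps%:E * return_time R X x w) < +oo)%E.

(* Main.v *)
Require Import Defs.
From mathcomp Require Import all_boot all_order all_algebra.
From mathcomp Require Import all_classical all_reals all_analysis.
From mathcomp Require Import ring lra measurable_realfun.
Set Implicit Arguments.
Unset Strict Implicit.
Unset Printing Implicit Defensive.
Import Order.TTheory GRing.Theory Num.Theory.
Import numFieldNormedType.Exports.
Local Open Scope classical_set_scope.
Local Open Scope ring_scope.

(** Everything is reduced to the geometric decay, in n, of three sequences
    attached to a state x: the returns Q^n(x,x) and P^n(x,x), and the tail
    P^x(sigma_x > n) of the return time.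

    For an irreducible substochastic A the numbers A^n(x,x) are
    supermultiplicative, so by a Fekete argument their roots converge to
    their supremum; hence rho(A) <= 1, with rho(A) < 1 exactly when A^n(x,x)
    decays (spectral_radius_lt1).  By irreducibility this decay does not
    depend on the entry considered (decays_entries).  On the other side, the
    tail of the return time is K^n 1 (x), where K is P with the transitions
    into x removed, and it decays exactly when some exponential moment is
    finite (exp_moment_decays, decays_exp_moment).  It remains to show that
    the tail decays at some state iff Q^n(x,x) decays and P^n(x,x) does not.

    The engine is defective_renewal.  Write A = B + E, where E leads into a
    finite set V.  Splitting at the first E-step expresses A^n h through B^n h
    and a renewal kernel on V.  If B^n h and the renewal kernel decay
    geometrically and the kernel has total mass less than 1 from each state of
    V, the mass stays less than 1 after a slight exponential tilt, so A^n h
    decays as well.  It is used three times, each time with a different reason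
    for the loss of mass.
    - With B = K and E the transitions into x: if the law of the first return
      decays and has mass less than 1, then P^n(x,x) decays.  So when P^n(x,x)
      does not decay, the return is almost sure and the decay passes to the
      tail (no_return_decays).
    - With A the kernel Q plus the lost transitions D = P - Q, except those
      into a fixed target v0 of D, and B = Q: the mass lost is the chance that
      the next D-step leads to v0.  Hence if Q^n(x,x) decays, so does the law
      of the first return of P to v0 (first_return_decays).
    - With A = Q, B the kernel Q without the transitions into x: the first
      return law of Q at x is dominated by the tail for P, and some mass leaks
      out at a transition where Q < P (perturbed_returns_decay).

    Finally P^n(x,x) cannot decay when the tail does: summing over the last
    visit to x before time n would make 1 a convolution of two decaying
    sequences (recurrent_not_decays).

    Strong positive recurrence asks for an actual chain.  It is realised on
    the unit interval with its uniform law, by nested subdivision into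
    half-open intervals indexed by finite paths (markov_chain_exists). *)

(** * Kernels acting on functions *)

Section KernelOperators.
Context {R : realType} {S : countType}.
Implicit Types (A B E : S -> S -> R) (h g : S -> \bar R).
Local Open Scope ereal_scope.

Lemma esumZl (T : choiceType) (c : R) (f : T -> \bar R) :
  (0 <= c)%R -> (forall t, 0 <= f t) ->
  \esum_(t in [set: T]) (c%:E * f t) = c%:E * \esum_(t in [set: T]) f t.
Proof.
move=> c0 f0.
have half (b : R) (g : T -> \bar R) : (0 <= b)%R -> (forall t, 0 <= g t) ->
    \esum_(t in [set: T]) (b%:E * g t) <= b%:E * \esum_(t in [set: T]) g t.
  move=> b0 g0; apply: ge_ereal_sup => _ [F [finF _] <-].
  rewrite -ge0_mule_fsumr//; apply: lee_pmul => //.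
    by apply: fsume_ge0.
  by apply: ereal_sup_ubound; exists F.
have [->|cn0] := eqVneq c 0%R.
  by rewrite esum1 ?mul0e// => t _; rewrite mul0e.
apply/eqP; rewrite eq_le half//=.
have ci0 : (0 <= c^-1)%R by rewrite invr_ge0.
have H : \esum_(t in [set: T]) f t <=
    c^-1%:E * \esum_(t in [set: T]) (c%:E * f t).
  rewrite [leLHS](eq_esum (b := fun t => c^-1%:E * (c%:E * f t))).
    by apply: half => // t; rewrite mule_ge0 ?lee_fin.
  by move=> t _; rewrite muleA -EFinM mulVf// mul1e.
have : c%:E * (\esum_(t in [set: T]) f t) <=
   c%:E * (c^-1%:E * \esum_(t in [set: T]) (c%:E * f t)).
  by apply: lee_wpmul2l => //; rewrite lee_fin.
by rewrite muleA -EFinM mulfV// mul1e.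
Qed.

(** Functions take extended nonnegative values, so that the operator is total
    and additive with no summability side condition. *)
Definition kop A h x : \bar R := \esum_(y in [set: S]) ((A x y)%:E * h y).

Definition kpow A n h : S -> \bar R := iter n (kop A) h.

Definition delta (y x : S) : \bar R := (x == y)%:R%:E.

Definition one (x : S) : \bar R := 1.

Definition col A y (x : S) : \bar R := (A x y)%:E.

Lemma kpowS A n h : kpow A n.+1 h = kop A (kpow A n h).
Proof. by []. Qed.

Lemma kpowSr A n h : kpow A n.+1 h = kpow A n (kop A h).
Proof. by rewrite /kpow iterSr. Qed.

Lemma kpowD A m n h : kpow A (m + n) h = kpow A m (kpow A n h).
Proof. by rewrite /kpow iterD. Qed.

Lemma matrix_powerE A n x y : matrix_power A n x y = kpow A n (delta y) x.
Proof.
elim: n x => [|n IH] x //=.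
by apply: eq_esum => z _; rewrite IH.
Qed.

Lemma delta_ge0 y x : 0 <= delta y x.
Proof. by rewrite lee_fin ler0n. Qed.

Lemma kop_ge0 A h : nonneg_matrix A -> (forall x, 0 <= h x) ->
  forall x, 0 <= kop A h x.
Proof.
by move=> A0 h0 x; apply: esum_ge0 => y _; rewrite mule_ge0 ?lee_fin.
Qed.

Lemma kpow_ge0 A h n : nonneg_matrix A -> (forall x, 0 <= h x) ->
  forall x, 0 <= kpow A n h x.
Proof. by move=> A0 h0; elim: n => //= n IH; apply: kop_ge0. Qed.

Lemma kpow_delta_ge0 A n x y : nonneg_matrix A -> 0 <= kpow A n (delta y) x.
Proof. by move=> A0; apply: kpow_ge0 => // z; exact: delta_ge0. Qed.

Lemma le_kop A B h g : nonneg_matrix A -> (forall x y, (A x y <= B x y)%R) ->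
  (forall x, 0 <= h x) -> (forall x, h x <= g x) ->
  forall x, kop A h x <= kop B g x.
Proof.
move=> A0 AB h0 hg x; apply: le_esum => y _.
by apply: lee_pmul; rewrite ?lee_fin.
Qed.

Lemma le_kpow A B n h g : nonneg_matrix A ->
  (forall x y, (A x y <= B x y)%R) ->
  (forall x, 0 <= h x) -> (forall x, h x <= g x) ->
  forall x, kpow A n h x <= kpow B n g x.
Proof.
move=> A0 AB h0 hg; elim: n => //= n IH.
by apply: le_kop => //; apply: kpow_ge0.
Qed.

Lemma kop_sum A (I : Type) (s : seq I) (h : I -> S -> \bar R) :
  nonneg_matrix A -> (forall i x, 0 <= h i x) ->
  kop A (fun x => \sum_(i <- s) h i x) = fun x => \sum_(i <- s) kop A (h i) x.
Proof.
move=> A0 h0; apply/funext => x; rewrite /kop.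
elim: s => [|i s IH].
  by rewrite big_nil esum1// => y _; rewrite big_nil mule0.
rewrite big_cons -IH -esumD.
- by apply: eq_esum => y _; rewrite big_cons ge0_muleDr// sume_ge0.
- by move=> y _; rewrite mule_ge0 ?lee_fin.
- by move=> y _; rewrite mule_ge0 ?lee_fin// sume_ge0.
Qed.

Lemma kopD A h g : nonneg_matrix A -> (forall x, 0 <= h x) ->
  (forall x, 0 <= g x) ->
  kop A (fun x => h x + g x) = fun x => kop A h x + kop A g x.
Proof.
move=> A0 h0 g0; apply/funext => x; rewrite /kop -esumD.
- by apply: eq_esum => y _; rewrite ge0_muleDr.
- by move=> y _; rewrite mule_ge0 ?lee_fin.
- by move=> y _; rewrite mule_ge0 ?lee_fin.
Qed.

Lemma kopZ A (c : R) h : nonneg_matrix A -> (0 <= c)%R ->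
  (forall x, 0 <= h x) ->
  kop A (fun x => c%:E * h x) = fun x => c%:E * kop A h x.
Proof.
move=> A0 c0 h0; apply/funext => x; rewrite /kop -esumZl//.
  by apply: eq_esum => y _; rewrite muleCA.
by move=> y; rewrite mule_ge0 ?lee_fin.
Qed.

Lemma kpow_sum A n (I : Type) (s : seq I) (h : I -> S -> \bar R) :
  nonneg_matrix A -> (forall i x, 0 <= h i x) ->
  kpow A n (fun x => \sum_(i <- s) h i x) =
  fun x => \sum_(i <- s) kpow A n (h i) x.
Proof.
move=> A0 h0; elim: n => //= n ->; rewrite kop_sum// => i.
exact: kpow_ge0.
Qed.

Lemma kpowD_fun A n h g : nonneg_matrix A -> (forall x, 0 <= h x) ->
  (forall x, 0 <= g x) ->
  kpow A n (fun x => h x + g x) = fun x => kpow A n h x + kpow A n g x.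
Proof.
by move=> A0 h0 g0; elim: n => //= n ->; rewrite kopD//; exact: kpow_ge0.
Qed.

Lemma kpowZ A n (c : R) h : nonneg_matrix A -> (0 <= c)%R ->
  (forall x, 0 <= h x) ->
  kpow A n (fun x => c%:E * h x) = fun x => c%:E * kpow A n h x.
Proof.
by move=> A0 c0 h0; elim: n => //= n ->; rewrite kopZ//; exact: kpow_ge0.
Qed.

Lemma kop_add A B h : nonneg_matrix A -> nonneg_matrix B ->
  (forall x, 0 <= h x) ->
  kop (fun x y => (A x y + B x y)%R) h = fun x => kop A h x + kop B h x.
Proof.
move=> A0 B0 h0; apply/funext => x; rewrite /kop -esumD.
- by apply: eq_esum => y _; rewrite EFinD ge0_muleDl// lee_fin.
- by move=> y _; rewrite mule_ge0 ?lee_fin.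
- by move=> y _; rewrite mule_ge0 ?lee_fin.
Qed.

(** Turns the action of a kernel into a finite sum, which is what makes the
    renewal argument below finite-dimensional. *)
Lemma kop_finite_targets A (V : seq S) h : uniq V -> nonneg_matrix A ->
  (forall x y, y \notin V -> A x y = 0%R) -> (forall x, 0 <= h x) ->
  kop A h = fun x => \sum_(v <- V) (col A v x * h v).
Proof.
move=> uV A0 AV h0; apply/funext => x.
rewrite fsbig_seq//.
rewrite -esum_fset//; last by move=> i _; rewrite mule_ge0 ?lee_fin.
rewrite [RHS]esum_mkcond; apply: eq_esum => y _.
case: ifPn => //; rewrite notin_setE /= => /negP yV.
by rewrite AV// mul0e.
Qed.

Lemma kop_delta A y : nonneg_matrix A -> kop A (delta y) = col A y.
Proof.
move=> A0; apply/funext => x; rewrite /kop.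
rewrite /col -(@esum_set1 _ _ y (fun z => (A x z)%:E)) ?lee_fin//.
rewrite [RHS]esum_mkcond; apply: eq_esum => z _.
rewrite /delta; have [->|zy] := eqVneq z y.
  by rewrite mem_set// mule1.
by rewrite mule0 memNset//; exact/eqP.
Qed.

Lemma le_term_kop A h x z : nonneg_matrix A -> (forall y, 0 <= h y) ->
  (A x z)%:E * h z <= kop A h x.
Proof.
move=> A0 h0; apply: ereal_sup_ubound; exists [set z].
  by split => //; exact: finite_set1.
by rewrite fsbig_set1.
Qed.

Lemma kop_one A x : kop A one x = \esum_(y in [set: S]) (A x y)%:E.
Proof. by apply: eq_esum => y _; rewrite mule1. Qed.

Definition substochastic A := nonneg_matrix A /\ forall x, kop A one x <= 1.

Lemma kpow_le1 A n h : substochastic A -> (forall x, 0 <= h x) ->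
  (forall x, h x <= 1) -> forall x, kpow A n h x <= 1.
Proof.
move=> [A0 A1] h0 h1; elim: n => //= n IH x.
apply: le_trans (A1 x); apply: le_kop => //.
exact: kpow_ge0.
Qed.

Lemma kpow_delta_le1 A n x y : substochastic A -> kpow A n (delta y) x <= 1.
Proof.
move=> sA; apply: kpow_le1 => // z; first exact: delta_ge0.
by rewrite /delta; case: eqP; rewrite lee_fin.
Qed.

Lemma kpow_delta_fin A n x y : substochastic A ->
  kpow A n (delta y) x \is a fin_num.
Proof.
move=> sA; have [A0 _] := sA.
rewrite ge0_fin_numE ?kpow_delta_ge0//.
by rewrite (le_lt_trans (kpow_delta_le1 _ _ _ sA))// ltry.
Qed.

Lemma kpow_gt0_fin A x y : substochastic A -> irreducible A ->
  exists n (c : R), (0 < c)%R /\ kpow A n (delta y) x = c%:E.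
Proof.
move=> sA iA; have [n _] := iA x y; rewrite matrix_powerE => pos.
exists n, (fine (kpow A n (delta y) x)).
by split; rewrite -?lte_fin fineK// kpow_delta_fin.
Qed.

Lemma col_le1 A x y : substochastic A -> col A y x <= 1.
Proof.
move=> [A0 A1]; rewrite -kop_delta//; apply: le_trans (A1 x).
apply: le_kop => // z; first exact: delta_ge0.
by rewrite /delta /one; case: eqP; rewrite lee_fin.
Qed.

(** One way to collect h after m steps is to sit at y at that time.  With h a
    power of A this is supermultiplicativity of the entries of the powers. *)
Lemma kpow_path A m h x y : nonneg_matrix A -> (forall z, 0 <= h z) ->
  h y \is a fin_num ->
  kpow A m (delta y) x * h y <= kpow A m h x.
Proof.
move=> A0 h0 hfin; rewrite -(fineK hfin) muleC.
have c0 : (0 <= fine (h y))%R by rewrite fine_ge0.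
have -> : (fine (h y))%:E * kpow A m (delta y) x =
   kpow A m (fun z => (fine (h y))%:E * delta y z) x.
  by rewrite kpowZ// => z; exact: delta_ge0.
apply: le_kpow => // z.
  by rewrite mule_ge0 ?lee_fin// delta_ge0.
rewrite /delta; case: eqP => [->|_]; last by rewrite mule0.
by rewrite mule1 fineK.
Qed.

Lemma irreducible_support A B : nonneg_matrix A -> nonneg_matrix B ->
  (forall x y, (0 < A x y)%R -> (0 < B x y)%R) ->
  irreducible A -> irreducible B.
Proof.
move=> A0 B0 AB iA x y; have [n n1 pos] := iA x y; exists n => //.
move: pos; rewrite !matrix_powerE; elim: n x {n1} => // n IH x.
rewrite !kpowS; apply: contraPlt => Bn.
have B_ge0 z : 0 <= kpow B n (delta y) z by exact: kpow_delta_ge0.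
rewrite /kop esum1 ?ltxx// => z _.
have [Axz|] := ltP 0%R (A x z); last first.
  by move=> Axz; rewrite (@le_anti _ _ (A x z) 0%R) ?mul0e// Axz A0.
have [/IH Bz|] := ltP 0 (kpow A n (delta y) z); last first.
  move=> h; rewrite (@le_anti _ _ (kpow A n (delta y) z) 0) ?mule0//.
  by rewrite h kpow_delta_ge0.
have := lt_le_trans (mule_gt0 _ Bz) (le_term_kop x z B0 B_ge0).
by rewrite lte_fin => /(_ (AB _ _ Axz)) => /lt_le_trans /(_ Bn); rewrite ltxx.
Qed.

End KernelOperators.

(** * Geometric decay and renewal *)

Section GeometricDecay.
Context {R : realType}.

Lemma sum_geometric_le (q : R) n : 0 <= q < 1 ->
  \sum_(k < n) q ^+ k <= (1 - q)^-1.
Proof.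
move=> /andP[q0 q1].
have q1' : 0 < 1 - q by rewrite subr_gt0.
rewrite -[leRHS]mul1r ler_pdivlMr// mulrC.
suff -> : (1 - q) * \sum_(k < n) q ^+ k = 1 - q ^+ n.
  by rewrite gerBl exprn_ge0.
by rewrite -opprB mulNr -subrX1 opprB.
Qed.

Lemma geometric_lt1 (q D : R) : 0 < q < 1 -> exists n, D * q ^+ n < 1.
Proof.
move=> /andP[q0 q1].
have /cvgrPdist_lt H : (fun n => q ^+ n) @ \oo --> (0 : R).
  by apply: cvg_expr; rewrite ger0_norm// ltW.
have D1 : 0 < `|D| + 1 by rewrite ltr_wpDl.
have := H (`|D| + 1)^-1; rewrite invr_gt0 => /(_ D1).
case=> n _ /(_ n (leqnn n)) /=.
rewrite sub0r normrN (ger0_norm (exprn_ge0 _ (ltW q0))) => Hn.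
exists n; have := Hn; rewrite -div1r ltr_pdivlMr//; apply: le_lt_trans.
rewrite mulrC ler_wpM2l ?exprn_ge0 ?(ltW q0)//.
by apply: le_trans (ler_norm D) _; rewrite lerDl.
Qed.

(** Convexity of a power between the points 1 and 1 + d. *)
Lemma expr_convex (l d : R) n : 0 <= l <= 1 -> 0 <= d ->
  (1 + l * d) ^+ n <= 1 - l + l * (1 + d) ^+ n.
Proof.
move=> /andP[l0 l1] d0; elim: n => [|n IH]; first by rewrite !expr0; lra.
have ge1 : 1 <= (1 + d) ^+ n by rewrite exprn_ege1// lerDl.
have ld : 0 <= 1 + l * d by rewrite addr_ge0// mulr_ge0.
rewrite exprS; apply: le_trans (ler_wpM2l ld IH) _.
rewrite [(1 + d) ^+ n.+1]exprS.
set e := (1 + d) ^+ n in ge1 *.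
have : 0 <= l * (1 - l) * d * (e - 1).
  by rewrite !mulr_ge0// subr_ge0.
by rewrite -subr_ge0 => H; rewrite -subr_ge0; apply: le_trans H _; lra.
Qed.

(** A defective sequence with a geometric tail has a finite exponential moment
    for some s0 > 1.  By convexity of powers, moving a small fraction of the way
    from 1 to s0 increases the total mass by an arbitrarily small amount, so it
    stays below 1.  The ratio t is the inverse of the tilt; it depends only on
    the bounds and not on the sequence, since the renewal argument needs the
    same t for all starting states. *)
Lemma tilt_defective (r C d : R) : 0 < r < 1 -> 0 <= C -> 0 < d ->
  exists t : R, [/\ 0 < t, r <= t, t < 1 & forall c : nat -> R,
    (forall k, 0 <= c k <= C * r ^+ k) ->
    (forall n, \sum_(k < n) c k <= 1 - d) ->
    forall n, \sum_(k < n) c k * t^-1 ^+ k.+1 <= 1 - d / 2].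
Proof.
move=> /andP[r0 r1] C0 d0.
have r1' : 0 < 1 + r by lra.
(* any s0 strictly between 1 and 1/r makes the tilted tail summable *)
pose s0 := 2 / (1 + r); pose q := r * s0.
have s01 : 1 < s0 by rewrite /s0 ltr_pdivlMr//; lra.
have rs : s0 <= r^-1.
  have ri1 : 1 <= r^-1 by rewrite invf_ge1// ltW.
  by rewrite /s0 ler_pdivrMr// mulrDr mulr1 mulVf ?gt_eqF//; lra.
have q0 : 0 <= q by rewrite mulr_ge0//; lra.
have q1 : q < 1 by rewrite /q /s0 mulrA ltr_pdivrMr//; lra.
pose M := C * s0 * (1 - q)^-1.
have M0 : 0 <= M by rewrite !mulr_ge0// ?invr_ge0; lra.
have dM : 0 < d + 2 * M by lra.
(* the fraction l of the way to s0 costs at most l * M <= d / 2 of mass *)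
pose l := d / (d + 2 * M).
have l0 : 0 < l by rewrite divr_gt0.
have l1 : l <= 1 by rewrite ler_pdivrMr//; lra.
have lM : l * M <= d / 2.
  rewrite /l mulrAC ler_pdivrMr// -mulrA; apply: ler_wpM2l; lra.
pose s := 1 + l * (s0 - 1).
have s1 : 1 < s by rewrite ltrDl mulr_gt0// subr_gt0.
have ss0 : s <= s0.
  have : l * (s0 - 1) <= 1 * (s0 - 1) by rewrite ler_pM2r ?subr_gt0//.
  by rewrite /s; lra.
have spos : 0 < s by lra.
exists s^-1; split.
- by rewrite invr_gt0.
- by rewrite -[r]invrK lef_pV2 ?posrE ?invr_gt0//; exact: le_trans rs.
- by rewrite invf_lt1.
move=> c cC cd n; rewrite invrK.
have c0 k : 0 <= c k by have /andP[] := cC k.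
have step : \sum_(k < n) c k * s ^+ k.+1 <=
    (1 - l) * (\sum_(k < n) c k) + l * (\sum_(k < n) c k * s0 ^+ k.+1).
  rewrite !mulr_sumr -big_split; apply: ler_sum => k _ /=.
  have -> : (1 - l) * c k + l * (c k * s0 ^+ k.+1) =
     c k * (1 - l + l * (1 + (s0 - 1)) ^+ k.+1) by rewrite subrKC; ring.
  apply: ler_wpM2l => //; apply: expr_convex; last by lra.
  by rewrite (ltW l0).
have s0sum : \sum_(k < n) c k * s0 ^+ k.+1 <= M.
  apply: (@le_trans _ _ (C * s0 * \sum_(k < n) q ^+ k)).
    rewrite mulr_sumr; apply: ler_sum => k _.
    rewrite exprS /q exprMn_comm ?/GRing.comm 1?mulrC//.
    have /andP[_ ck] := cC k.
    have -> : C * s0 * (r ^+ k * s0 ^+ k) = s0 * s0 ^+ k * (C * r ^+ k) by ring.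
    by apply: ler_wpM2l => //; rewrite mulr_ge0 ?exprn_ge0; lra.
  apply: ler_wpM2l; first by rewrite mulr_ge0//; lra.
  by apply: sum_geometric_le; rewrite q0.
have dle1 : 0 <= 1 - d by have := cd 0%N; rewrite big_ord0.
have e1 : (1 - l) * (\sum_(k < n) c k) <= 1 - d.
  apply: (@le_trans _ _ ((1 - l) * (1 - d))).
    by apply: ler_wpM2l => //; lra.
  by rewrite mulrBl mul1r gerBl mulr_ge0// ltW.
have e2 : l * (\sum_(k < n) c k * s0 ^+ k.+1) <= l * M.
  by apply: ler_wpM2l => //; lra.
lra.
Qed.

Local Open Scope ereal_scope.

(** Only an upper bound: the sequences of interest are nonnegative, and for an
    upper bound monotonicity and sums are immediate. *)
Definition decays (u : nat -> \bar R) := exists r C : R,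
  [/\ (0 < r < 1)%R, (0 <= C)%R & forall n, u n <= (C * r ^+ n)%:E].

Lemma decays_le u v : (forall n, u n <= v n) -> decays v -> decays u.
Proof.
move=> uv [r [C [r01 C0 H]]]; exists r, C; split=> // n.
exact: le_trans (uv n) (H n).
Qed.

Lemma decays0 : decays (fun=> 0).
Proof.
exists (2^-1)%R, 0%R; split=> //; first by apply/andP; split; lra.
Qed.

Lemma decaysD u v : decays u -> decays v -> decays (fun n => u n + v n).
Proof.
move=> [r [C [/andP[r0 r1] C0 H]]] [s [D [/andP[s0 s1] D0 K]]].
exists (Num.max r s), (C + D)%R; split.
- by rewrite lt_max r0/= gt_max r1.
- by rewrite addr_ge0.
- move=> n; rewrite mulrDl EFinD; apply: leeD.
    apply: le_trans (H n) _; rewrite lee_fin ler_wpM2l// lerXn2r//.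
    + by rewrite nnegrE ltW.
    + by rewrite nnegrE le_max ltW.
    + by rewrite le_max lexx.
  apply: le_trans (K n) _; rewrite lee_fin ler_wpM2l// lerXn2r//.
  + by rewrite nnegrE ltW.
  + by rewrite nnegrE le_max ltW.
  + by rewrite le_max lexx orbT.
Qed.

Lemma decays_sum (I : eqType) (s : seq I) (u : I -> nat -> \bar R) :
  (forall i, i \in s -> decays (u i)) -> decays (fun n => \sum_(i <- s) u i n).
Proof.
elim: s => [|i s IH] H.
  by apply: decays_le decays0 => n; rewrite big_nil.
apply: (@decays_le _ (fun n => u i n + \sum_(j <- s) u j n)).
  by move=> n; rewrite big_cons.
apply: decaysD; first by apply: H; rewrite mem_head.
by apply: IH => j js; apply: H; rewrite in_cons js orbT.
Qed.

Lemma decaysZ (c : R) u : (0 <= c)%R -> decays u ->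
  decays (fun n => c%:E * u n).
Proof.
move=> c0 [r [C [r01 C0 H]]]; exists r, (c * C)%R; split=> //.
  by rewrite mulr_ge0.
by move=> n; rewrite -mulrA EFinM lee_wpmul2l// lee_fin.
Qed.

Lemma decays_shift m u : decays u -> decays (fun n => u (m + n)%N).
Proof.
move=> [r [C [/andP[r0 r1] C0 H]]]; exists r, C; split=> //.
  by rewrite r0.
move=> n; apply: le_trans (H _) _; rewrite lee_fin ler_wpM2l// exprD.
rewrite ler_piMl ?exprn_ge0// ?exprn_ile1// ltW//.
Qed.

Lemma decays_unshift u : (forall n, u n <= 1) -> decays (fun n => u n.+1) ->
  decays u.
Proof.
move=> u1 [r [C [/andP[r0 r1] C0 H]]].
exists r, (Num.max 1 (C / r))%R; split.
- by rewrite r0.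
- by rewrite le_max ler01.

case=> [|n].
  by apply: le_trans (u1 _) _; rewrite lee_fin expr0 mulr1 le_max lexx.
apply: le_trans (H n) _; rewrite lee_fin exprS mulrA.
apply: ler_wpM2r; first by rewrite exprn_ge0// ltW.
rewrite -ler_pdivrMr//; by rewrite le_max lexx orbT.
Qed.

End GeometricDecay.

Section Renewal.
Context {R : realType} {S : countType}.
Implicit Types (A B E : S -> S -> R) (h g : S -> \bar R).
Local Open Scope ereal_scope.

(** Expansion of a path of A according to the time k of its first E-step. *)
Lemma first_step_decomposition B E h n : nonneg_matrix B -> nonneg_matrix E ->
  (forall x, 0 <= h x) ->
  let A := fun x y => (B x y + E x y)%R in
  forall x, kpow A n h x =
    kpow B n h x + \sum_(k < n) kpow B k (kop E (kpow A (n.-1 - k) h)) x.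
Proof.
move=> B0 E0 h0 A.
have A0 : nonneg_matrix A by move=> x y; rewrite addr_ge0.
elim: n => [|n IH] x; first by rewrite big_ord0 adde0.
rewrite kpowS (kop_add B0 E0); last exact: kpow_ge0.
have Eh k : forall z, 0 <= kop E (kpow A k h) z.
  by apply: kop_ge0 => //; exact: kpow_ge0.
rewrite (_ : kpow A n h = fun z => kpow B n h z +
    \sum_(k <- index_enum 'I_n) kpow B k (kop E (kpow A (n.-1 - k) h)) z);
  last first.
  by apply/funext => z; rewrite IH.
rewrite kopD//; last 2 first.
- exact: kpow_ge0.
- by move=> z; rewrite sume_ge0// => k _; apply: kpow_ge0.
rewrite kop_sum//; last by move=> k z; apply: kpow_ge0.
rewrite -addeA; congr (_ + _).
rewrite big_ord_recl /= subn0 addeC; congr (_ + _).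
  by congr kop; apply/funext => z; rewrite IH.
apply: eq_bigr => k _; by rewrite /bump /= add0n add1n -subn1 -subnDA add1n.
Qed.

(** Expansion of a path of A according to the time k of its last E-step. *)
Lemma last_step_decomposition B E h n : nonneg_matrix B -> nonneg_matrix E ->
  (forall x, 0 <= h x) ->
  let A := fun x y => (B x y + E x y)%R in
  forall x, kpow A n h x =
    kpow B n h x + \sum_(k < n) kpow A k (kop E (kpow B (n.-1 - k) h)) x.
Proof.
move=> B0 E0 h0 A.
have A0 : nonneg_matrix A by move=> x y; rewrite addr_ge0.
elim: n => [|n IH] x; first by rewrite big_ord0 adde0.
rewrite kpowS.
have Eh k : forall z, 0 <= kop E (kpow B k h) z.
  by apply: kop_ge0 => //; exact: kpow_ge0.
rewrite (_ : kpow A n h = fun z => kpow B n h z +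
    \sum_(k <- index_enum 'I_n) kpow A k (kop E (kpow B (n.-1 - k) h)) z);
  last first.
  by apply/funext => z; rewrite IH.
rewrite kopD//; last 2 first.
- exact: kpow_ge0.
- by move=> z; rewrite sume_ge0// => k _; apply: kpow_ge0.
rewrite kop_sum//; last by move=> k z; apply: kpow_ge0.
rewrite (kop_add B0 E0); last exact: kpow_ge0.
rewrite -addeA; congr (_ + _).
rewrite big_ord_recl /= subn0; congr (_ + _).
apply: eq_bigr => k _; by rewrite /bump /= add0n add1n -subn1 -subnDA add1n.
Qed.

Lemma uniform_gt0 (I : eqType) (s : seq I) (T : I -> R -> Prop) :
  (forall i a b, T i a -> (0 < b <= a)%R -> T i b) ->
  (forall i, i \in s -> exists2 a : R, (0 < a)%R & T i a) ->
  exists2 a : R, (0 < a)%R & forall i, i \in s -> T i a.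
Proof.
move=> down; elim: s => [|i s IH] H; first by exists 1%R.
have [|a a0 Ha] := IH; first by move=> j js; apply: H; rewrite in_cons js orbT.
have [|b b0 Hb] := H i; first by rewrite mem_head.
exists (Num.min a b) => [|j]; first by rewrite lt_min a0.
rewrite in_cons => /predU1P[->|js].
  by apply: down Hb _; rewrite lt_min a0 b0 /= ge_min lexx orbT.
by apply: down (Ha j js) _; rewrite lt_min a0 b0 /= ge_min lexx.
Qed.

(** After the first E-step the path restarts from a state of V, so the values
    a_n(v) = A^n h (v), for v in V, are bounded by B^n h (v) plus the
    convolution of the renewal masses c_k(v) = B^k E 1 (v) with earlier values.
    With the ratio t of tilt_defective, a bound a_j <= L t^j on V for all j < n
    reproduces itself at n: the convolution contributes at most
    (1 - d/2) L t^n, and L = 2C/d leaves room for C r^n. *)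
Lemma defective_renewal B E (V : seq S) h : uniq V ->
  nonneg_matrix B -> nonneg_matrix E ->
  (forall x y, y \notin V -> E x y = 0%R) -> (forall x, 0 <= h x) ->
  (forall v, v \in V -> decays (fun n => kpow B n h v)) ->
  (forall v, v \in V -> decays (fun n => kpow B n (kop E one) v)) ->
  (forall v, v \in V -> exists2 d : R, (0 < d)%R &
     forall n, \sum_(k < n) kpow B k (kop E one) v <= (1 - d)%:E) ->
  forall v, v \in V ->
  decays (fun n => kpow (fun x y => (B x y + E x y)%R) n h v).
Proof.
move=> uV B0 E0 EV h0 dh dE dS.
set A := fun x y => _.
have A0 : nonneg_matrix A by move=> x y; rewrite addr_ge0.
pose c k v := kpow B k (kop E one) v.
have one0 x : 0 <= one x :> \bar R by rewrite lee_fin.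
have c0 k v : 0 <= c k v by apply: kpow_ge0 => //; exact: kop_ge0.
have b0 k v : 0 <= kpow B k h v by exact: kpow_ge0.
have := @decays_sum R _ V (fun v n => kpow B n h v + c n v).
case; first by move=> v vV; apply: decaysD; [exact: dh|exact: dE].
move=> r [C [r01 C0 rC]].
have bc n v : v \in V -> kpow B n h v + c n v <= (C * r ^+ n)%:E.
  move=> vV; apply: le_trans (rC n).
  rewrite (bigD1_seq v)//= leeDl// sume_ge0// => w _; exact: adde_ge0.
have bC n v : v \in V -> kpow B n h v <= (C * r ^+ n)%:E.
  by move=> vV; apply: le_trans (bc _ _ vV); rewrite leeDl.
have cC n v : v \in V -> c n v <= (C * r ^+ n)%:E.
  by move=> vV; apply: le_trans (bc n _ vV); rewrite leeDr.
have [|//|d d0 Hd] := @uniform_gt0 _ V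
    (fun v d => forall n, \sum_(k < n) c k v <= (1 - d)%:E).
  move=> v a b H /andP[_ ba] n; apply: le_trans (H n) _.
  by rewrite lee_fin; lra.
have [t [t0 rt t1 Ht]] := @tilt_defective _ r C d r01 C0 d0.
pose L := (2 * C / d)%R.
have L0 : (0 <= L)%R by rewrite divr_ge0// ?mulr_ge0// ltW.
have r0 : (0 < r)%R by case/andP: r01.
suff H : forall n v, v \in V -> kpow A n h v <= (L * t ^+ n)%:E.
  by move=> v vV; exists t, L; split; [rewrite t0|by []|move=> n; exact: H].
elim/ltn_ind => n IH v vV.
have cfin k : c k v \is a fin_num.
  by rewrite ge0_fin_numE// (le_lt_trans (cC k v vV))// ltry.
rewrite first_step_decomposition//.
have term (k : 'I_n) : kpow B k (kop E (kpow A (n.-1 - k) h)) v <=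
    (L * t ^+ n * (fine (c k v) * t^-1 ^+ k.+1))%:E.
  have kn := ltn_ord k.
  have jn : (n.-1 - k < n)%N.
    apply: leq_ltn_trans (leq_subr _ _) _.
    by rewrite ltn_predL (leq_trans _ kn).
  have Lt0 : (0 <= L * t ^+ (n.-1 - k))%R by rewrite mulr_ge0// exprn_ge0// ltW.
  have -> : (L * t ^+ n * (fine (c k v) * t^-1 ^+ k.+1) =
             L * t ^+ (n.-1 - k) * fine (c k v))%R.
    have n0 : (0 < n)%N by apply: leq_trans kn.
    have nE : (n = n.-1 - k + k.+1)%N.
      by rewrite addnS subnK ?prednK// -ltnS prednK.
    rewrite [in (t ^+ n)%R]nE exprD exprVn.
    have tk : (t ^+ k.+1 != 0)%R by rewrite expf_neq0// gt_eqF.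
    by field.
  rewrite EFinM (fineK (cfin k)).
  rewrite [leRHS](_ : _ = kpow B k
    (fun x => (L * t ^+ (n.-1 - k))%:E * kop E one x) v); last first.
    by rewrite kpowZ//; exact: kop_ge0.
  apply: le_kpow => //; first by apply: kop_ge0 => //; exact: kpow_ge0.
  (* E charges only V, where the induction hypothesis applies *)
  move=> x; rewrite !(kop_finite_targets uV E0 EV)//; last exact: kpow_ge0.
  rewrite ge0_sume_distrr; last by move=> i _; rewrite mule_ge0 ?lee_fin.
  rewrite big_seq [leRHS]big_seq; apply: lee_sum => w wV.
  by rewrite mule1 muleC lee_wpmul2r ?lee_fin// IH.
apply: (@le_trans _ _ (C * r ^+ n +
    \sum_(k < n) (L * t ^+ n * (fine (c k v) * t^-1 ^+ k.+1)))%:E).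
  by rewrite EFinD -sumEFin leeD// ?bC//; apply: lee_sum.
rewrite lee_fin -mulr_sumr.
have S1 : (\sum_(k < n) (fine (c k v) * t^-1 ^+ k.+1) <= 1 - d / 2)%R.
  apply: (Ht (fun k => fine (c k v))) => [k|m].
    by rewrite fine_ge0//= -lee_fin fineK// cC.
  rewrite -lee_fin -sumEFin (eq_bigr (fun k : 'I_m => c k v)) ?Hd//.
  by move=> k _; rewrite fineK.
have tn0 : (0 <= t ^+ n)%R by rewrite exprn_ge0// ltW.
have rtn : (r ^+ n <= t ^+ n)%R by rewrite lerXn2r // nnegrE ltW.
apply: (@le_trans _ _ (C * t ^+ n + L * t ^+ n * (1 - d / 2))%R).
  by apply: lerD; apply: ler_wpM2l => //; rewrite mulr_ge0.
suff -> : (C * t ^+ n + L * t ^+ n * (1 - d / 2) = L * t ^+ n)%R by [].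
rewrite /L; have dn0 : (d != 0)%R by rewrite gt_eqF.
by field.
Qed.

(** Groups the survivors of step n + 1 with the mass that exits through g at
    that step; conservation of mass when B 1 + g is the constant 1. *)
Lemma exit_step B g n x : nonneg_matrix B -> (forall z, 0 <= g z) ->
  kpow B n.+1 one x + \sum_(k < n.+1) kpow B k g x =
  kpow B n (fun z => kop B one z + g z) x + \sum_(k < n) kpow B k g x.
Proof.
move=> B0 g0; rewrite big_ord_recr /= addeA addeAC -kpowS kpowSr.
by rewrite kpowD_fun//; exact: kop_ge0.
Qed.

Lemma exit_probability_le1 B g n x : nonneg_matrix B -> (forall z, 0 <= g z) ->
  (forall z, kop B one z + g z <= 1) ->
  kpow B n one x + \sum_(k < n) kpow B k g x <= 1.
Proof.
move=> B0 g0 H; elim: n x => [|n IH] x; first by rewrite big_ord0 adde0.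
rewrite exit_step//; apply: le_trans (IH x); rewrite leeD2r//.
by apply: le_kpow => // z; rewrite adde_ge0// kop_ge0.
Qed.

Lemma exit_probability_eq1 B g n x : nonneg_matrix B -> (forall z, 0 <= g z) ->
  (forall z, kop B one z + g z = 1) ->
  kpow B n one x + \sum_(k < n) kpow B k g x = 1.
Proof.
move=> B0 g0 H; elim: n x => [|n IH] x; first by rewrite big_ord0 adde0.
rewrite exit_step// -[RHS](IH x); congr (kpow B n _ x + _).
by apply/funext => z; exact: H.
Qed.

End Renewal.

(** * First returns and perturbed kernels *)

Section FirstReturn.
Context {R : realType} {S : countType}.
Implicit Types (A B E P Q : S -> S -> R) (h g : S -> \bar R).
Local Open Scope ereal_scope.

(** Removing the transitions into x, rather than out of x, lets the starting
    point be x itself: n steps of avoid x A are the paths of length n that do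
    not come back to x. *)
Definition avoid x A (y z : S) : R := if z == x then 0%R else A y z.
Definition enter x A (y z : S) : R := if z == x then A y z else 0%R.

Lemma avoid_enter x A : (fun y z => (avoid x A y z + enter x A y z)%R) = A.
Proof.
by apply/funext => y; apply/funext => z; rewrite /avoid /enter; case: ifP;
  rewrite ?add0r ?addr0.
Qed.

Lemma avoid_ge0 x A : nonneg_matrix A -> nonneg_matrix (avoid x A).
Proof. by move=> A0 y z; rewrite /avoid; case: ifP. Qed.

Lemma enter_ge0 x A : nonneg_matrix A -> nonneg_matrix (enter x A).
Proof. by move=> A0 y z; rewrite /enter; case: ifP. Qed.

Lemma one_ge0 (x : S) : 0 <= one x :> \bar R.
Proof. by rewrite lee_fin. Qed.

Lemma kop_enter x A h : nonneg_matrix A -> (forall z, 0 <= h z) ->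
  kop (enter x A) h = fun y => h x * col A x y.
Proof.
move=> A0 h0; rewrite (@kop_finite_targets _ _ _ [:: x])//.
- by apply/funext => y; rewrite big_seq1 /col /enter eqxx muleC.
- exact: enter_ge0.
- by move=> y z; rewrite inE /enter => /negbTE ->.
Qed.

Lemma kop_enter_one x A : nonneg_matrix A -> kop (enter x A) one = col A x.
Proof.
move=> A0; rewrite kop_enter//.
by apply/funext => y; rewrite mul1e.
Qed.

Lemma kop_one_avoid x A y : nonneg_matrix A ->
  kop (avoid x A) one y + col A x y = kop A one y.
Proof.
move=> A0; rewrite -{3}(avoid_enter x A) kop_add//.
- by rewrite kop_enter_one.
- exact: avoid_ge0.
- exact: enter_ge0.
Qed.

(** At index n this is the probability of a first return at time n + 1; with
    the companion no_return, the tail is P^x(sigma_x > n). *)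
Definition first_return A x n := kpow (avoid x A) n (col A x) x.
Definition no_return A x n := kpow (avoid x A) n one x.

Lemma col_ge0 A x y : nonneg_matrix A -> 0 <= col A x y.
Proof. by move=> A0; rewrite lee_fin. Qed.

Lemma first_return_ge0 A x n : nonneg_matrix A -> 0 <= first_return A x n.
Proof.
move=> A0; apply: kpow_ge0; first exact: avoid_ge0.
by move=> y; exact: col_ge0.
Qed.

Lemma no_return_ge0 A x n : nonneg_matrix A -> 0 <= no_return A x n.
Proof. by move=> A0; apply: kpow_ge0; [exact: avoid_ge0|exact: one_ge0]. Qed.

(** Renewal at the visits to x: if a return is not certain and its law has a
    geometric tail, the Green sequence decays. *)
Lemma defective_return_decays A x : nonneg_matrix A ->
  decays (first_return A x) ->
  (exists2 d : R, (0 < d)%R &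
     forall n, \sum_(k < n) first_return A x k <= (1 - d)%:E) ->
  decays (fun n => kpow A n (delta x) x).
Proof.
move=> A0 df Sf; have aA0 := avoid_ge0 x A0; have eA0 := enter_ge0 x A0.
rewrite -{1}(avoid_enter x A).
apply: (@defective_renewal _ _ _ _ [:: x]) => //.
- by move=> y z; rewrite inE /enter => /negbTE ->.
- exact: delta_ge0.
- move=> v; rewrite inE => /eqP ->; apply: decays_unshift.
    move=> [|n]; first by rewrite /= /delta eqxx.
    rewrite kpowSr kop_delta// (_ : col _ _ = fun z => 0%:E * one z).
      by rewrite kpowZ// mul0e.
    by apply/funext => z; rewrite /col /avoid eqxx mul0e.
  apply: decays_le decays0 => n.
  rewrite kpowSr kop_delta// (_ : col _ _ = fun z => 0%:E * one z).
    by rewrite kpowZ// mul0e.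
  by apply/funext => z; rewrite /col /avoid eqxx mul0e.
- by move=> v; rewrite inE => /eqP ->; rewrite kop_enter_one.
- by move=> v; rewrite inE => /eqP ->; rewrite kop_enter_one.
- exact: mem_head.
Qed.

Definition stochastic A := nonneg_matrix A /\ forall x, kop A one x = 1.

Lemma stochastic_sub A : stochastic A -> substochastic A.
Proof. by move=> [A0 A1]; split=> // x; rewrite A1. Qed.

Lemma no_return_complement P x n : stochastic P ->
  no_return P x n + \sum_(k < n) first_return P x k = 1.
Proof.
move=> [P0 P1]; apply: exit_probability_eq1.
- exact: avoid_ge0.
- by move=> z; exact: col_ge0.
- by move=> z; rewrite kop_one_avoid.
Qed.

(** By defective_return_decays the first-return law must have total mass 1, so
    the tail of the return time is a tail sum of that law. *)
Lemma no_return_decays P x : stochastic P ->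
  decays (first_return P x) ->
  ~ decays (fun n => kpow P n (delta x) x) ->
  decays (no_return P x).
Proof.
move=> sP df nP; have [P0 P1] := sP.
have full (d : R) : (0 < d)%R ->
    exists n, (1 - d)%:E < \sum_(k < n) first_return P x k.
  move=> d0; apply: contrapT => H; apply: nP.
  apply: defective_return_decays => //; exists d => // n.
  by rewrite leNgt; apply/negP => Hn; apply: H; exists n.
have [r [C [r01 C0 fC]]] := df.
have /andP[r0 r1] := r01.
have fin k : first_return P x k \is a fin_num.
  rewrite ge0_fin_numE ?first_return_ge0//.
  by rewrite (le_lt_trans (fC k))// ltry.
pose f k := fine (first_return P x k).
have f0 k : (0 <= f k)%R by rewrite fine_ge0// first_return_ge0.
have fCr k : (f k <= C * r ^+ k)%R by rewrite -lee_fin fineK.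
have Sf n : \sum_(k < n) first_return P x k = (\sum_(k < n) f k)%:E.
  by rewrite -sumEFin; apply: eq_bigr => k _; rewrite fineK.
exists r, (C / (1 - r))%R; split=> //.
  by rewrite divr_ge0// subr_ge0 ltW.
move=> n; have := no_return_complement x n sP; rewrite Sf.
move=> /(congr1 (fun z => z - (\sum_(k < n) f k)%:E)); rewrite addeK// => ->.
rewrite -EFinB lee_fin; apply/ler_addgt0Pr => d d0.
have [N] := full d d0; rewrite Sf lte_fin => HN.
have mono : (\sum_(k < N) f k <= \sum_(k < n + N) f k)%R.
  rewrite -!(big_mkord xpredT f) [leRHS](@big_cat_nat _ _ _ N)//= ?leq_addl//.
  by rewrite lerDl sumr_ge0.
rewrite big_split_ord /= in mono.
have tail : (\sum_(k < N) f (n + k)%N <= C / (1 - r) * r ^+ n)%R.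
  apply: (@le_trans _ _ (C * r ^+ n * \sum_(k < N) r ^+ k)%R).
    by rewrite mulr_sumr; apply: ler_sum => k _; rewrite -mulrA -exprD.
  rewrite [leRHS]mulrAC; apply: ler_wpM2l.
    by rewrite mulr_ge0// exprn_ge0// ltW.
  by apply: sum_geometric_le; rewrite r1 ltW.
lra.
Qed.

(** Decompose at the last visit to x before time n: the total probability 1 is
    the sum over k of P^k(x,x) times the probability of no return during the
    remaining n - k steps.  If both factors decay like C r^n this is of order
    n r^n, which tends to 0. *)
Lemma recurrent_not_decays P x : stochastic P -> decays (no_return P x) ->
  ~ decays (fun n => kpow P n (delta x) x).
Proof.
move=> [P0 P1] dn dP.
have [r [C [/andP[r0 r1] C0 H]]] := decaysD dn dP.
have Pd0 n : 0 <= kpow P n (delta x) x by exact: kpow_delta_ge0.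
have H1 n : no_return P x n <= (C * r ^+ n)%:E.
  by apply: le_trans (H n); rewrite leeDl.
have H2 n : kpow P n (delta x) x <= (C * r ^+ n)%:E.
  by apply: le_trans (H n); rewrite leeDr// no_return_ge0.
(* q^2 = r: one factor q^n absorbs n, the other still tends to 0 *)
pose q := Num.sqrt r.
have q0 : (0 < q)%R by rewrite sqrtr_gt0.
have qq : (q ^+ 2 = r)%R by rewrite sqr_sqrtr// ltW.
have q1 : (q < 1)%R.
  by rewrite -(@ltr_pXn2r _ 2)// ?nnegrE ?(ltW q0)// qq expr1n.
have nq n : (n%:R * q ^+ n <= (1 - q)^-1)%R.
  apply: le_trans (sum_geometric_le n _); last by rewrite q1 (ltW q0).
  rewrite mulr_natl -[X in (_ *+ X <= _)%R]card_ord -sumr_const.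
  apply: ler_sum => k _; rewrite ler_wiXn2l ?(ltW q0) ?(ltW q1)//.
  exact: ltnW.
have total n : (1 <= (C + C * C / (1 - q)) * q ^+ n)%R.
  have : kpow P n one x = 1.
    have kp : forall m, kpow P m one = one.
      by elim=> //= m ->; apply/funext => z; exact: P1.
    by rewrite kp.
  rewrite -{1}(avoid_enter x P) last_step_decomposition; last 3 first.
  - exact: avoid_ge0.
  - exact: enter_ge0.
  - exact: one_ge0.
  rewrite avoid_enter => E1; rewrite -lee_fin -E1.
  have term (k : 'I_n) : kpow P k (kop (enter x P)
     (kpow (avoid x P) (n.-1 - k) one)) x <= (C * C * r ^+ n)%:E.
    rewrite kop_enter//; last first.
      by apply: kpow_ge0; [exact: avoid_ge0|exact: one_ge0].
    rewrite -/(no_return P x _).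
    have n0 : (0 < n)%N by apply: leq_ltn_trans (ltn_ord k).
    have := H1 (n.-1 - k)%N; have := no_return_ge0 x (n.-1 - k) P0.
    move: (no_return P x _) => [t| |]//.
    rewrite !lee_fin => t0 tC.
    rewrite kpowZ//; last by move=> z; exact: col_ge0.
    rewrite -kop_delta// -kpowSr.
    have -> : (C * C * r ^+ n = C * r ^+ (n.-1 - k) * (C * r ^+ k.+1))%R.
      have nE : (n = n.-1 - k + k.+1)%N.
        by rewrite addnS subnK ?prednK// -ltnS prednK.
      by rewrite [in LHS]nE exprD; ring.
    by rewrite EFinM lee_pmul.
  have rq : (r ^+ n <= q ^+ n)%R.
    by rewrite lerXn2r ?nnegrE ?(ltW q0) ?(ltW r0)// -qq ger_pMl// ltW.
  apply: (@le_trans _ _ (C * r ^+ n + (C * C * r ^+ n) *+ n)%:E).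
    rewrite EFinD leeD ?H1//.
    rewrite -[X in (_ *+ X)%R]card_ord -sumr_const -sumEFin.
    exact: lee_sum.
  rewrite lee_fin mulrDl lerD ?ler_wpM2l// -mulr_natl.
  have -> : (n%:R * (C * C * r ^+ n) = C * C * ((n%:R * q ^+ n) * q ^+ n))%R.
    by rewrite -qq -exprM mulnC exprM expr2; ring.
  rewrite -[leRHS]mulrA ler_wpM2l ?mulr_ge0//.
  by rewrite mulrC [leRHS]mulrC ler_wpM2l ?nq// exprn_ge0// ltW.
have [|n Hn] := @geometric_lt1 R q (C + C * C / (1 - q))%R; first by rewrite q0.
by have := lt_le_trans Hn (total n); rewrite ltxx.
Qed.

Lemma le_partial_sums (f : nat -> \bar R) m n : (forall k, 0 <= f k) ->
  (m <= n)%N -> \sum_(k < m) f k <= \sum_(k < n) f k.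
Proof.
move=> f0 mn; rewrite -(subnKC mn) big_split_ord /= leeDl//.
by rewrite sume_ge0.
Qed.

(** If a and b share at most unit mass, a single positive term of b bounds the
    mass of a away from 1. *)
Lemma leak_defective (a b : nat -> \bar R) j : (forall k, 0 <= a k) ->
  (forall k, 0 <= b k) -> 0 < b j ->
  (forall n, \sum_(k < n) (a k + b k) <= 1) ->
  exists2 d : R, (0 < d)%R & forall n, \sum_(k < n) a k <= (1 - d)%:E.
Proof.
move=> a0 b0 bj H.
have key n : \sum_(k < n) a k + b j <= 1.
  apply: le_trans (H (n + j.+1)%N); rewrite big_split/= leeD//.
    by apply: le_partial_sums => //; rewrite leq_addr.
  apply: (@le_trans _ _ (\sum_(k < j.+1) b k)).
    by rewrite big_ord_recr /= leeDr// sume_ge0.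
  by apply: le_partial_sums => //; rewrite leq_addl.
have bfin : b j \is a fin_num.
  rewrite ge0_fin_numE// (@le_lt_trans _ _ 1) ?ltry//.
  by have := key 0%N; rewrite big_ord0 add0e.
exists (fine (b j)) => [|n]; first by rewrite fine_gt0// bj -ge0_fin_numE.
by rewrite EFinB fineK// leeBrDr.
Qed.

(** Prolong a path from u to v into a loop at x by fixed paths from x to u and
    from v to x, each of positive weight. *)
Lemma decays_entries A x u v : substochastic A -> irreducible A ->
  decays (fun n => kpow A n (delta x) x) ->
  decays (fun n => kpow A n (delta v) u).
Proof.
move=> sA iA dA; have [A0 _] := sA.
have [a [c [c0 Ha]]] := kpow_gt0_fin x u sA iA.
have [b [e [e0 Hb]]] := kpow_gt0_fin v x sA iA.
apply: (@decays_le _ _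
  (fun n => (c * e)^-1%:E * kpow A (a + b + n) (delta x) x)).
  move=> n; rewrite -(@lee_pmul2l _ (c * e)%:E) ?fin_numE ?lte_fin ?mulr_gt0//.
  rewrite muleA -EFinM mulfV ?gt_eqF ?mulr_gt0// mul1e.
  rewrite addnAC -addnA kpowD.
  have d0 m z : 0 <= kpow A m (delta x) z by exact: kpow_delta_ge0.
  apply: le_trans (kpow_path a x (y := u) A0 _ (kpow_delta_fin _ _ _ sA)) => //.
  rewrite Ha EFinM -muleA lee_wpmul2l ?lee_fin ?(ltW c0)// muleC kpowD.
  by rewrite -Hb; apply: kpow_path => //; exact: kpow_delta_fin.
apply: decaysZ; first by rewrite invr_ge0 mulr_ge0 ?ltW.
exact: (decays_shift (a + b) dA).
Qed.

(** Such a g is dominated by a finite sum of indicators of points. *)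
Lemma decays_finite_support A (U : seq S) g v : nonneg_matrix A ->
  (forall z, 0 <= g z <= 1) -> (forall z, z \notin U -> g z = 0) ->
  (forall u, decays (fun n => kpow A n (delta u) v)) ->
  decays (fun n => kpow A n g v).
Proof.
move=> A0 g01 gU dA.
have g0 z : 0 <= g z by have /andP[] := g01 z.
apply: (@decays_le _ _ (fun n => \sum_(u <- U) kpow A n (delta u) v));
  last first.
  by apply: decays_sum.
move=> n; have := @kpow_sum _ _ A n _ U delta A0 (fun y x => delta_ge0 y x).
move=> /(congr1 (fun f => f v)) <-; apply: le_kpow => // z.
have [zU|/gU ->] := boolP (z \in U); last first.
  by rewrite sume_ge0// => u _; exact: delta_ge0.
rewrite (big_rem z)//= /delta eqxx; have /andP[_ gz] := g01 z.
by rewrite -[leLHS]adde0 leeD// sume_ge0// => u _; rewrite lee_fin ler0n.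
Qed.

Section Perturbation.
Variables (P Q : S -> S -> R).
Hypotheses (sP : stochastic P) (sQ : substochastic Q) (iQ : irreducible Q).
Hypothesis (QP : forall x y, (Q x y <= P x y)%R).
Let D x y := (P x y - Q x y)%R.

Let P0 : nonneg_matrix P. Proof. by case: sP. Qed.
Let Q0 : nonneg_matrix Q. Proof. by case: sQ. Qed.
Let D0 : nonneg_matrix D.
Proof. by move=> x y; rewrite subr_ge0. Qed.

Let PE : (fun x y => (Q x y + D x y)%R) = P.
Proof. by apply/funext => x; apply/funext => y; rewrite /D addrC subrK. Qed.

Let kopP h : (forall x, 0 <= h x) ->
  forall x, kop Q h x + kop D h x = kop P h x.
Proof. by move=> h0 x; rewrite -PE kop_add. Qed.

Let kopD_le1 x : kop D one x <= 1.
Proof.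
by have := kopP (@one_ge0) x; rewrite (proj2 sP) => <-; rewrite leeDr// kop_ge0.
Qed.

Variables (u0 v0 : S).
Hypothesis (uv : (Q u0 v0 < P u0 v0)%R).

Let Duv : 0 < col D v0 u0.
Proof. by rewrite lte_fin subr_gt0. Qed.

(** The first returns of Q are dominated by the no-return tail of P.  They have
    defective mass because the Q-path may reach u0 before returning to x and
    lose there the mass P - Q. *)
Lemma perturbed_returns_decay x : decays (no_return P x) ->
  decays (fun n => kpow Q n (delta x) x).
Proof.
move=> dP; have aQ0 := avoid_ge0 x Q0.
have g0 z : 0 <= kop D one z by exact: kop_ge0.
apply: defective_return_decays => //.
  apply: decays_le dP => n; apply: le_kpow => //.
  - by move=> y z; rewrite /avoid; case: ifP.
  - by move=> z; exact: col_ge0.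
  - by move=> z; exact: col_le1.
(* u0 can be reached without returning to x: cut a path at its last visit *)
have [j Hj] : exists j, 0 < kpow (avoid x Q) j (kop D one) x.
  apply: contrapT => H.
  have H0 j : kpow (avoid x Q) j (kop D one) x = 0.
    apply/eqP; rewrite eq_le kpow_ge0// andbT leNgt; apply/negP => Hj.
    by apply: H; exists j.
  have [n [c [c0 Hc]]] := kpow_gt0_fin x u0 sQ iQ.
  have : c%:E * (fine (kop D one u0))%:E <= kpow Q n (kop D one) x.
    rewrite -Hc; have fin : kop D one u0 \is a fin_num.
      by rewrite ge0_fin_numE// (@le_lt_trans _ _ 1) ?ltry.
    by rewrite fineK//; exact: kpow_path.
  rewrite -{1}(avoid_enter x Q) last_step_decomposition//; last first.
    exact: enter_ge0.
  rewrite H0 add0e big1 => [|k _].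
    rewrite -EFinM lee_fin leNgt mulr_gt0// fine_gt0//.
    have Dle : col D v0 u0 <= kop D one u0.
      rewrite -kop_delta//; apply: le_kop => // z; first exact: delta_ge0.
      by rewrite /delta /one; case: eqP; rewrite lee_fin.
    by rewrite (lt_le_trans Duv Dle)/= (@le_lt_trans _ _ 1) ?ltry.
  rewrite avoid_enter kop_enter//; last exact: kpow_ge0.
  rewrite H0 kpowZ//; first by rewrite mul0e.
  by move=> z; exact: col_ge0.
apply: (@leak_defective (first_return Q x)
  (fun k => kpow (avoid x Q) k (kop D one) x) j) => //.
- by move=> k; exact: first_return_ge0.
- by move=> k; exact: kpow_ge0.
move=> n; apply: (@le_trans _ _ (\sum_(k < n)
    kpow (avoid x Q) k (fun z => col Q x z + kop D one z) x)).
  by apply: lee_sum => k _; rewrite kpowD_fun// => z; exact: col_ge0.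
apply: le_trans (exit_probability_le1 n x aQ0
  (g := fun z => col Q x z + kop D one z) _ _).
- by rewrite leeDr// kpow_ge0.
- by move=> z; rewrite adde_ge0// col_ge0.
- by move=> z; rewrite addeA kop_one_avoid// kopP// (proj2 sP).
Qed.

Variables (U V : seq S).
Hypothesis (DU : forall x y, x \notin U -> D x y = 0%R).
Hypothesis (DV : forall x y, y \notin V -> D x y = 0%R).

(** Without its transitions into v0, the kernel P is bounded by Q plus E, the
    transitions of D not entering v0, and everything that Q does before the
    next D-step decays.  From each state the next D-step leads to v0 with positive
    probability, since Q can reach u0; this is the defect needed for renewal
    in the targets of D. *)
Lemma first_return_decays : decays (fun n => kpow Q n (delta v0) v0) ->
  decays (first_return P v0).
Proof.
move=> dQ; have dQ' u v := decays_entries u v sQ iQ dQ.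
pose E := avoid v0 D.
have E0 : nonneg_matrix E by exact: avoid_ge0.
have v0V : v0 \in undup V.
  rewrite mem_undup; apply/negP => /negP /DV => /(_ u0) D0'.
  by move: Duv; rewrite /col D0' ltxx.
have colE z : col D v0 z + kop E one z = kop D one z.
  by rewrite addeC kop_one_avoid.
apply: (@decays_le _ _
  (fun n => kpow (fun x y => (Q x y + E x y)%R) n (col P v0) v0)).
  move=> n; apply: le_kpow => //.
  - exact: avoid_ge0.
  - move=> x y; rewrite /E /avoid; case: ifP => _; first by rewrite addr0.
    by rewrite /D subrKC.
  - by move=> z; exact: col_ge0.
have Uzero z : z \notin U -> kop D one z = 0.
  by move=> zU; rewrite /kop esum1// => y _; rewrite DU// mul0e.
have colD z : 0 <= col D v0 z <= kop D one z.
  by rewrite col_ge0//= -colE leeDl// kop_ge0.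
have kopE z : 0 <= kop E one z <= kop D one z.
  by rewrite kop_ge0//= -colE leeDr// col_ge0.
apply: (@defective_renewal _ _ _ _ (undup V)) => //.
- exact: undup_uniq.
- by move=> x y; rewrite mem_undup => /DV H; rewrite /E /avoid H; case: ifP.
- by move=> z; exact: col_ge0.
- move=> v _; apply: (@decays_le _ _ (fun n =>
    kpow Q n.+1 (delta v0) v + kpow Q n (col D v0) v)).
    move=> n; rewrite kpowSr kop_delta//.
    have -> : kpow Q n (col Q v0) v + kpow Q n (col D v0) v =
       kpow Q n (fun z => col Q v0 z + col D v0 z) v.
      by rewrite kpowD_fun// => z; exact: col_ge0.
    apply: le_kpow => // z; first exact: col_ge0.
    by rewrite /col -EFinD lee_fin /D subrKC.
  apply: decaysD; first exact: (@decays_shift _ 1%N _ (dQ' v v0)).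
  apply: (@decays_finite_support _ U) => // z.
    by have /andP[-> /le_trans ->] := colD z.
  move=> zU; apply/eqP; rewrite eq_le -(Uzero z zU).
  by have /andP[h1 ->] := colD z; rewrite (Uzero z zU).
- move=> v _; apply: (@decays_finite_support _ U) => // z.
    by have /andP[-> /le_trans ->] := kopE z.
  move=> zU; apply/eqP; rewrite eq_le -(Uzero z zU).
  by have /andP[h1 ->] := kopE z; rewrite (Uzero z zU).
move=> v _; have [j [c [c0 Hc]]] := kpow_gt0_fin v u0 sQ iQ.
apply: (@leak_defective (fun k => kpow Q k (kop E one) v)
  (fun k => kpow Q k (col D v0) v) j).
- by move=> k; apply: kpow_ge0 => // z; exact: kop_ge0.
- by move=> k; apply: kpow_ge0 => // z; exact: col_ge0.
- apply: lt_le_trans (kpow_path j v (y := u0) Q0 _ _) => //.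
    by rewrite Hc mule_gt0.
  by move=> z; exact: col_ge0.
move=> n; apply: (@le_trans _ _ (\sum_(k < n) kpow Q k (kop D one) v)).
  apply: lee_sum => k _.
  rewrite -(_ : kpow Q k (fun z => kop E one z + col D v0 z) v =
                kpow Q k (kop D one) v).
    by rewrite kpowD_fun// => z; [exact: kop_ge0|exact: col_ge0].
  by congr (kpow Q k _ v); apply/funext => z; rewrite kop_one_avoid.
apply: le_trans (exit_probability_le1 n v Q0 (g := kop D one) _ _).
- by rewrite leeDr// kpow_ge0.
- by move=> z; exact: kop_ge0.
- by move=> z; rewrite kopP// (proj2 sP).
Qed.

End Perturbation.
End FirstReturn.

(** * The spectral radius *)

Section SpectralRadius.
Context {R : realType}.

Definition root_rate (a : nat -> R) : R :=
  sup [set a m `^ m%:R^-1 | m in [set m | (0 < m)%N]].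

Variable a : nat -> R.
Hypotheses (a0 : forall n, 0 <= a n) (a1 : forall n, a n <= 1).
Hypothesis aM : forall m n, a m * a n <= a (m + n)%N.
Hypothesis a_0 : a 0%N = 1.

Let L := root_rate a.
Let E := [set a m `^ m%:R^-1 | m in [set m | (0 < m)%N]].

Let powV m : (0 < m)%N -> (a m `^ m%:R^-1) ^+ m = a m.
Proof.
move=> m0; rewrite -powR_mulrn ?powR_ge0// -powRrM mulVf ?powRr1//.
by rewrite pnatr_eq0 -lt0n.
Qed.

Let root_le m c : (0 < m)%N -> 0 <= c ->
  (a m `^ m%:R^-1 <= c) = (a m <= c ^+ m).
Proof.
by move=> m0 c0; rewrite -{2}(powV m0) ler_pXn2r// nnegrE ?powR_ge0.
Qed.

Let E_sup : has_sup E.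
Proof.
split; first by exists (a 1%N `^ 1%:R^-1), 1%N.
by exists 1 => _ [m m0 <-]; rewrite root_le// expr1n.
Qed.

Lemma root_rate_ge m : (0 < m)%N -> a m `^ m%:R^-1 <= L.
Proof. by move=> m0; apply: sup_upper_bound => //; exists m. Qed.

Lemma root_rate_ge0 : 0 <= L.
Proof. by apply: le_trans (root_rate_ge (ltn0Sn 0)); exact: powR_ge0. Qed.

Lemma root_rate_exp m : (0 < m)%N -> a m <= L ^+ m.
Proof. by move=> m0; rewrite -root_le ?root_rate_ge ?root_rate_ge0. Qed.

Lemma root_rate_le c : 0 <= c ->
  (forall m, (0 < m)%N -> a m <= c ^+ m) -> L <= c.
Proof.
move=> c0 H; apply: ge_sup; first by case: E_sup.
by move=> _ [m m0 <-]; rewrite root_le// H.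
Qed.

Lemma root_rate_le1 : L <= 1.
Proof. by apply: root_rate_le => // m _; rewrite expr1n. Qed.

Lemma supermul_iter n0 m q : a n0 * a m ^+ q <= a (n0 + q * m)%N.
Proof.
elim: q => [|q IH]; first by rewrite expr0 mulr1 mul0n addn0.
rewrite exprSr mulrA mulSn addnCA addnC.
by apply: le_trans (aM _ _); apply: ler_wpM2r.
Qed.

(** In each residue class modulo m the least n0 with a n0 > 0 is a base from
    which every later index of the class is reached by steps of length m.  This
    handles periodic sequences: classes with no positive term impose nothing. *)
Lemma root_lower_bound m : (0 < m)%N -> 0 < a m ->
  exists2 k, 0 < k & forall n, 0 < a n -> k * (a m `^ m%:R^-1) ^+ n <= a n.
Proof.
move=> m0 am0; set b := a m `^ m%:R^-1.
have b0 : 0 <= b by exact: powR_ge0.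
have b1 : b <= 1 by rewrite /b root_le// expr1n.
have [r k c Hk /andP[c0 ck] n an nr||k k0 Hk] := @uniform_gt0 R _ (iota 0 m)
   (fun r k => forall n, 0 < a n -> (n %% m)%N = r -> k * b ^+ n <= a n).
- by apply: le_trans (Hk n an nr); rewrite ler_wpM2r// exprn_ge0.
- move=> r _.
  have [[n0 /andP[/eqP nr an0]]|H] :=
    pselect (exists n, ((n %% m)%N == r) && (0 < a n)); last first.
    exists 1 => // n an nr; exfalso; apply: H; exists n.
    by rewrite nr eqxx.
  have ex : exists n, ((n %% m)%N == r) && (0 < a n).
    by exists n0; rewrite nr eqxx.
  case: (ex_minnP ex) => {an0 nr}n0 /andP[/eqP nr an0] min.
  exists (a n0) => // n an nrn.
  have le0 : (n0 <= n)%N by apply: min; rewrite nrn eqxx.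
  have dv : (m %| n - n0)%N by rewrite -eqn_mod_dvd// nrn nr.
  have nE : (n = n0 + (n - n0) %/ m * m)%N by rewrite divnK// subnKC.
  rewrite {2}nE; apply: le_trans (supermul_iter _ _ _).
  apply: ler_wpM2l => //; rewrite -(powV m0) -/b -exprM.
  by rewrite ler_wiXn2l// [leqRHS]nE mulnC leq_addl.
- exists k => // n an; apply: Hk (an) (erefl _).
  by rewrite mem_iota add0n ltn_mod.
Qed.

(** The Fekete argument: any root a_m^(1/m) close to the supremum bounds a_n
    from below by a multiple of its n-th power. *)
Lemma root_rate_cvg :
  a n `^ n%:R^-1 @[n --> within [set n | 0 < a n] \oo] --> L.
Proof.
apply/cvgrPdist_lt => e e0.
pose c := Num.max (L - e / 2) 0.
have c0 : 0 <= c by rewrite le_max lexx orbT.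
have ec : L - e < c by rewrite lt_max; apply/orP; left; lra.
suff [N HN] : exists N, forall n, (N <= n)%N -> 0 < a n -> c ^+ n <= a n.
  exists N.+1 => // n Nn /= an.
  have n0 : (0 < n)%N by apply: leq_trans Nn.
  have gL := root_rate_ge n0; rewrite ger0_norm ?subr_ge0//.
  suff : c <= a n `^ n%:R^-1 by lra.
  rewrite -(@ler_pXn2r _ n)// ?nnegrE ?powR_ge0// powV// HN//.
  exact: ltnW.
have [LE|Le] := leP (L - e / 2) 0.
  exists 1%N => n n1 an; rewrite /c max_r// expr0n.
  by rewrite (gtn_eqF n1) ltW.
have cE : c = L - e / 2 by rewrite /c max_l// ltW.
have e2 : 0 < e / 2 by lra.
have [_ [m m0 <-]] := sup_adherent e2 E_sup.
rewrite -[sup E]/L -cE; set b := a m `^ _ => cb.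
have b0 : 0 < b by apply: le_lt_trans cb.
have am0 : 0 < a m by rewrite -(powV m0) exprn_gt0.
have [k k0 Hk] := root_lower_bound m0 am0.
have q01 : 0 < c / b < 1.
  by rewrite divr_gt0 ?ltr_pdivrMr ?mul1r// cE.
have [N HN] := geometric_lt1 k^-1 q01.
exists N => n Nn an; apply: le_trans (Hk n an); rewrite -/b.
have qn : (c / b) ^+ n <= k.
  have /andP[q0 q1] := q01.
  apply: (@le_trans _ _ ((c / b) ^+ N)); first by rewrite ler_wiXn2l// ltW.
  by move: HN; rewrite mulrC ltr_pdivrMr// mul1r => /ltW.
rewrite -ler_pdivrMr ?exprn_gt0// -expr_div_n//.
Qed.

(** A bound C r^n valid for all n improves to r^n, as the powers of a_m are
    bounded by the terms of index a multiple of m. *)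
Lemma root_rate_lt1 : (L < 1) <-> exists r C, [/\ 0 < r < 1, 0 <= C &
   forall n, a n <= C * r ^+ n].
Proof.
split=> [L1|[r [C [/andP[r0 r1] C0 H]]]].
  pose r := (L + 1) / 2; have L0 := root_rate_ge0.
  exists r, 1; split=> //; first by rewrite /r; apply/andP; split; lra.
  move=> [|n]; rewrite mul1r; first by rewrite a_0 expr0.
  apply: le_trans (root_rate_exp _) _ => //.
  by rewrite lerXn2r ?nnegrE// /r; lra.
apply: le_lt_trans r1; apply: root_rate_le => [|m m0]; first exact: ltW.
rewrite leNgt; apply/negP => rm.
have am0 : 0 < a m by apply: lt_trans rm; rewrite exprn_gt0.
have q01 : 0 < r ^+ m / a m < 1.
  by rewrite divr_gt0 ?exprn_gt0//= ltr_pdivrMr// mul1r.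
have [n] := geometric_lt1 C q01; rewrite ltNge => /negP; apply.
rewrite expr_div_n mulrA ler_pdivlMr ?exprn_gt0// mul1r.
have := supermul_iter 0 m n; rewrite a_0 mul1r add0n => /le_trans -> //.
by apply: le_trans (H _) _; rewrite -exprM mulnC.
Qed.

End SpectralRadius.

Section SpectralRadiusKernel.
Context {R : realType} {S : countType}.
Variables (A : S -> S -> R) (x : S).
Hypotheses (sA : substochastic A) (iA : irreducible A).
Local Open Scope ereal_scope.

Let a n := fine (kpow A n (delta x) x).

Let fin n : kpow A n (delta x) x = (a n)%:E.
Proof. by rewrite fineK// kpow_delta_fin. Qed.

Let A0 : nonneg_matrix A. Proof. by case: sA. Qed.
Let a0 n : (0 <= a n)%R. Proof. by rewrite -lee_fin -fin kpow_delta_ge0. Qed.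
Let a1 n : (a n <= 1)%R.
Proof. by rewrite -lee_fin -fin kpow_delta_le1. Qed.
Let aM m n : (a m * a n <= a (m + n)%N)%R.
Proof.
rewrite -lee_fin EFinM -!fin kpowD; apply: kpow_path => //.
- by move=> z; exact: kpow_delta_ge0.
- exact: kpow_delta_fin.
Qed.
Let a_0 : a 0%N = 1%R.
Proof. by rewrite /a /= /delta eqxx. Qed.

Lemma spectral_radiusE : spectral_radius A x = (root_rate a)%:E.
Proof.
rewrite /spectral_radius.
pose L := [set n : nat | (0 < a n)%R].
have -> : [set n : nat | 0 < matrix_power A n x x] = L.
  by apply/seteqP; split => n /=; rewrite matrix_powerE fin lte_fin.
have -> : (fun n : nat => poweR (matrix_power A n x x) n%:R^-1) =
    (fun n => (powR (a n) n%:R^-1)%:E).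
  by apply/funext => n; rewrite matrix_powerE fin poweR_EFin.
have PF : ProperFilter (within L \oo).
  apply: Build_ProperFilter_ex => P [N _ HN].
  have [m m1] := iA x x; rewrite matrix_powerE fin lte_fin => am.
  exists (N * m)%N; apply: HN; first by rewrite /= leq_pmulr.
  rewrite /L /=; apply: lt_le_trans _ (supermul_iter a0 aM 0 m N).
  by rewrite a_0 mul1r exprn_gt0.
apply: cvg_lim; first exact: ereal_hausdorff.
apply: cvg_EFin; first exact: nearW.
exact: root_rate_cvg.
Qed.

Lemma spectral_radius_le1 : spectral_radius A x <= 1.
Proof. by rewrite spectral_radiusE lee_fin root_rate_le1. Qed.

Lemma spectral_radius_lt1 :
  spectral_radius A x < 1 <-> decays (fun n => kpow A n (delta x) x).
Proof.
rewrite spectral_radiusE lte_fin root_rate_lt1//; split=> -[r [C [r01 C0 H]]];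
  exists r, C; split=> // n; have := H n; by rewrite fin lee_fin.
Qed.

End SpectralRadiusKernel.

(** * The law of the return time *)

Section ChainLaw.
Local Open Scope ereal_scope.

(** Countable additivity, transported along the enumeration of S. *)
Lemma measure_bigcup_countType d (T : measurableType d) (R : realType)
    (mu : measure T R) (S : countType) (F : S -> set T) :
  (forall z, measurable (F z)) -> trivIset setT F ->
  mu (\bigcup_z F z) = \esum_(z in [set: S]) mu (F z).
Proof.
move=> mF tF.
pose D := range (@pickle S).
pose G n := if @unpickle S n is Some z then F z else set0.
have GE z : G (pickle z) = F z by rewrite /G pickleK.
have -> : \bigcup_z F z = \bigcup_(n in D) G n.
  apply/seteqP; split => [w [z _ Fz]|w [_ [z _ <-]]].
    by exists (pickle z); [exists z|rewrite GE].
  by rewrite GE => Fz; exists z.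
rewrite measure_bigcup; last 2 first.
- by move=> _ [z _ <-]; rewrite GE.
- move=> _ _ [y _ <-] [z _ <-]; rewrite !GE => H.
  by rewrite (tF y z I I H).
rewrite nneseries_esum// (_ : [set x | x \in D] = D); last first.
  by apply/seteqP; split => x /=; rewrite inE.
rewrite (@reindex_esum _ _ _ [set: S] D pickle); last first.
  by apply: inj_bij; move=> y z _ _; exact: (pcan_inj pickleK).
by apply: eq_esum => z _; rewrite GE.
Qed.

(** The integral of a nonnegative function is a supremum over the simple
    functions below it, so monotonicity holds for arbitrary functions, among
    them the exponential of the return time. *)
Lemma le_integral_nonneg d (T : measurableType d) (R : realType)
    (mu : measure T R) (f g : T -> \bar R) : (forall w, 0 <= f w) ->
  (forall w, f w <= g w) -> \int[mu]_w f w <= \int[mu]_w g w.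
Proof.
move=> f0 fg; have g0 w : 0 <= g w by exact: le_trans (fg w).
rewrite !ge0_integralTE//; apply: le_ereal_sup => _ [h hf <-].
by exists h => // w; exact: le_trans (fg w).
Qed.

Lemma expeR_ge0 (R : realType) (z : \bar R) : 0 <= expeR z.
Proof. by case: z => [r| |]//=; rewrite lee_fin expR_ge0. Qed.

Section ReturnTime.
Context {R : realType} {S : countType} (P : S -> S -> R) (x : S).
Hypothesis P0 : nonneg_matrix P.
Context {d : measure_display} {Omega : measurableType d}.
Variables (mu : probability Omega R) (X : nat -> Omega -> S).
Hypothesis cX : markov_chain P x mu X.

Definition path_event (s : nat -> S) n :=
  [set w | forall k, (k <= n)%N -> X k w = s k].
Definition avoid_event n m :=
  [set w | forall k, (n < k <= n + m)%N -> X k w <> x].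

Let mX k y : measurable [set w | X k w = y].
Proof. by case: cX. Qed.

Lemma measurable_path_event s n : measurable (path_event s n).
Proof.
rewrite (_ : path_event s n =
  \bigcap_(k in [set k | (k <= n)%N]) [set w | X k w = s k])//.
by apply: bigcap_measurable => //; exists 0%N.
Qed.

Lemma measurable_avoid_event n m : measurable (avoid_event n m).
Proof.
rewrite (_ : avoid_event n m = \bigcap_k
  (if (n < k <= n + m)%N then ~` [set w | X k w = x] else setT)).
  apply: bigcap_measurable; first by exists 0%N.
  by move=> k _; case: ifP => // _; exact: measurableC.
apply/seteqP; split => w H k; first by move=> _; case: ifP => //; exact: H.
by move=> nk; have := H k I; rewrite nk.
Qed.

(** The Markov property beyond finite paths: condition on the position at time
    n + 1, which has to be a state other than x. *)
Lemma path_then_avoid m s n :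
  mu (path_event s n `&` avoid_event n m) =
  mu (path_event s n) * kpow (avoid x P) m one (s n).
Proof.
have aP0 := avoid_ge0 x P0.
elim: m s n => [|m IH] s n.
  rewrite /= mule1 (_ : avoid_event n 0 = setT) ?setIT//.
  apply/seteqP; split => // w _ k; rewrite addn0 => /andP[nk kn].
  by have := leq_ltn_trans kn nk; rewrite ltnn.
pose s' z k := if k == n.+1 then z else s k.
have s'n z k : (k <= n)%N -> s' z k = s k.
  by move=> kn; rewrite /s' ltn_eqF.
have s'S z : s' z n.+1 = z by rewrite /s' eqxx.
pose F z := if z == x then set0
  else path_event (s' z) n.+1 `&` avoid_event n.+1 m.
have -> : path_event s n `&` avoid_event n m.+1 = \bigcup_z F z.
  apply/seteqP; split => [w [Ps An]|w [z _]].
    exists (X n.+1 w) => //; rewrite /F.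
    have -> : (X n.+1 w == x) = false.
      by apply/negbTE/eqP; apply: An; rewrite ltnSn addnS ltnS leq_addr.
    split => [k|k /andP[nk km]].
      rewrite leq_eqVlt ltnS => /predU1P[->|kn]; first by rewrite s'S.
      by rewrite s'n// Ps.
    by apply: An; rewrite (ltnW nk) /= addnS -addSn.
  rewrite /F; case: eqP => // zx [Ps An]; split => [k kn|k /andP[nk km]].
    by rewrite Ps ?s'n// (leq_trans kn).
  move: nk; rewrite leq_eqVlt => /predU1P[<-|nk].
    by rewrite Ps// s'S.
  by apply: An; rewrite nk addSn -addnS.
rewrite measure_bigcup_countType; last 2 first.
- move=> z; rewrite /F; case: ifP => // _.
  apply: measurableI; first exact: measurable_path_event.
  exact: measurable_avoid_event.
- move=> y z _ _; rewrite /F; case: ifP => _; first by rewrite set0I => -[].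
  case: ifP => _; first by rewrite setI0 => -[].
  by move=> [w [[Py _] [Pz _]]]; have := Py n.+1 (leqnn _); rewrite Pz// !s'S.
have fin : mu (path_event s n) \is a fin_num.
  by apply: fin_num_measure; exact: measurable_path_event.
rewrite -(fineK fin) kpowS -esumZl; last 2 first.
- by rewrite fine_ge0.
- by move=> z; rewrite mule_ge0 ?lee_fin// kpow_ge0.
apply: eq_esum => z _; rewrite /F fineK// /avoid.
case: ifP => [/eqP zx|zx]; first by rewrite measure0 mul0e mule0.
apply: etrans (IH (s' z) n.+1) _; rewrite s'S muleA; congr (_ * _).
have [_ _ mk] := cX.
rewrite /path_event mk s'S s'n//; congr (mu _ * _).
by apply/seteqP; split => w H k kn; have := H k kn; rewrite s'n.
Qed.

(** The event that X_0 differs from x is null and is discarded. *)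
Lemma no_return_law m : mu (avoid_event 0 m) = no_return P x m.
Proof.
have [_ X0 _] := cX.
have X0' : mu (path_event (fun=> x) 0) = 1.
  rewrite -X0; congr (mu _); apply/seteqP; split => w /=; first exact.
  by move=> Xw k; rewrite leqn0 => /eqP ->.
have := path_then_avoid m (fun=> x) 0.
rewrite X0' mul1e -[kpow _ _ _ _]/(no_return P x m) => <-.
have mC := measurableC (measurable_path_event (fun=> x) 0).
have N0 : mu (~` path_event (fun=> x) 0) = 0.
  rewrite probability_setC; last exact: measurable_path_event.
  by rewrite X0' subee.
rewrite -[in LHS](setIT (avoid_event 0 m)).
rewrite -(setUv (path_event (fun=> x) 0)) setIUr.
rewrite measureU0; first by rewrite setIC.
- apply: measurableI; first exact: measurable_avoid_event.
  exact: measurable_path_event.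
- apply: measurableI => //; exact: measurable_avoid_event.
- apply/eqP; rewrite eq_le measure_ge0 andbT -[leRHS]N0; apply: le_measure.
  + by rewrite inE; apply: measurableI => //; exact: measurable_avoid_event.
  + by rewrite inE.
  + exact: subIsetr.
Qed.

Lemma return_time_gt m w : avoid_event 0 m w ->
  m.+1%:R%:E <= return_time R X x w :> \bar R.
Proof.
move=> H; apply: le_ereal_inf_tmp => _ [k [k0 Xk] <-].
rewrite lee_fin ler_nat ltnNge; apply/negP => km.
by apply: (H k) => //; rewrite k0.
Qed.

Lemma return_timeP w :
  (exists2 m, avoid_event 0 m w & return_time R X x w = m.+1%:R%:E :> \bar R) \/
  (forall m, avoid_event 0 m w).
Proof.
have [[k kP]|H] := pselect (exists k, (0 < k)%N && (X k w == x)); last first.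
  right => m k /andP[k0 _] Xk; apply: H; exists k.
  by rewrite k0 Xk eqxx.
left; have ex : exists k, (0 < k)%N && (X k w == x) by exists k.
have [[|m] /andP[// _ /eqP Xm] min] := ex_minnP ex.
have A : avoid_event 0 m w.
  move=> j /andP[k0]; rewrite add0n => km Xk.
  by have := min j; rewrite k0 Xk eqxx => /(_ isT); rewrite ltnNge km.
exists m => //; apply/eqP; rewrite eq_le return_time_gt// andbT.
by apply: ereal_inf_lbound; exists m.+1.
Qed.

(** Markov inequality. *)
Lemma exp_moment_decays (eps : R) : (0 < eps)%R ->
  \int[mu]_w expeR (eps%:E * return_time R X x w) < +oo ->
  decays (no_return P x).
Proof.
move=> eps0 I.
have I0 : 0 <= \int[mu]_w expeR (eps%:E * return_time R X x w).
  by apply: integral_ge0 => w _; exact: expeR_ge0.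
pose C := fine (\int[mu]_w expeR (eps%:E * return_time R X x w)).
have CE : \int[mu]_w expeR (eps%:E * return_time R X x w) = C%:E.
  by rewrite fineK// ge0_fin_numE.
exists (expR (- eps)), C; split.
- by rewrite expR_gt0/= -expR0 ltr_expR oppr_lt0.
- by rewrite -lee_fin -CE.
move=> n; rewrite -expRM_natl mulrN expRN.
have pos : (0 < expR (n%:R * eps))%R by exact: expR_gt0.
rewrite EFinM lee_pdivlMr// -CE -no_return_law.
have mA := measurable_avoid_event 0 n.
rewrite -[avoid_event 0 n]setIT -integral_indic// muleC -ge0_integralZl//=;
  last first.
  by apply: measurableT_comp => //; exact: measurable_indic.
apply: le_integral_nonneg => w.
  by rewrite -EFinM lee_fin mulr_ge0// ltW.
rewrite indicE.
have [/set_mem Aw|_] := boolP (w \in avoid_event 0 n); last first.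
  by rewrite mule0 expeR_ge0.
rewrite mule1; have := return_time_gt Aw.
case: (return_time R X x w) => [t| |]//.
  rewrite lee_fin => nt; rewrite -EFinM /= lee_fin ler_expR mulrC ler_pM2l//.
  by apply: le_trans nt; rewrite ler_nat.
by move=> _; rewrite gt0_muley ?lte_fin//= leey.
Qed.

(** If sigma = m + 1 then the path avoids x up to time m, so exp(eps sigma) is
    at most the sum over n of exp(eps (n + 1)) times the indicator of no return
    up to time n; this also holds when sigma is infinite, the series being then
    divergent.  Integrating gives a geometric series. *)
Lemma decays_exp_moment : decays (no_return P x) ->
  exists2 eps : R, (0 < eps)%R &
    \int[mu]_w expeR (eps%:E * return_time R X x w) < +oo.
Proof.
move=> [r [C [/andP[r0 r1] C0 H]]].
(* then exp(eps) * r is the square root of r *)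
pose eps := (- ln r / 2)%R.
have eps0 : (0 < eps)%R by rewrite divr_gt0// oppr_gt0 ln_lt0// r0.
pose q := (expR eps * r)%R.
have q0 : (0 < q)%R by rewrite mulr_gt0// expR_gt0.
have q1 : (q < 1)%R.
  rewrite /q -{1}(lnK r0) -expRD -expR0 ltr_expR /eps.
  have : (ln r < 0)%R by rewrite ln_lt0// r0.
  by lra.
exists eps => //.
pose u n w : \bar R := (expR (eps *+ n.+1))%:E * (\1_(avoid_event 0 n) w)%:E.
have u0 n w : 0 <= u n w by rewrite mule_ge0 ?lee_fin ?expR_ge0.
have mA n := measurable_avoid_event 0 n.
have mI n : measurable_fun setT (fun w => (\1_(avoid_event 0 n) w)%:E : \bar R).
  apply: measurableT_comp => //; exact: measurable_indic.
have cvu w : cvgn (fun n => \sum_(0 <= i < n) u i w).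
  by apply: is_cvg_nneseries => i _ _.
apply: (@le_lt_trans _ _ (\int[mu]_w \sum_(n <oo) u n w)).
  apply: le_integral_nonneg => w; first exact: expeR_ge0.
  have part N : \sum_(0 <= n < N) u n w <= \sum_(n <oo) u n w.
    by apply: nneseries_lim_ge => i _ _.
  have [[m Am ->]|Ainf] := return_timeP w.
    apply: le_trans (part m.+1); rewrite big_nat_recr//= -[leLHS]add0e leeD//.
      by rewrite sume_ge0.
    by rewrite /u indicE mem_set// mule1 mulr_natr.
  suff E : \sum_(n <oo) u n w = +oo by apply: le_trans (leey _) _; rewrite -E.
  apply/eqyP => A A0.
  have [N AN] : exists N : nat, (A <= N%:R)%R.
    by exists (Num.bound A); apply/ltW; apply: archi_boundP; exact: ltW.
  apply: le_trans (part N).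
  apply: (@le_trans _ _ N%:R%:E); first by rewrite lee_fin.
  rewrite -[X in X%:R%:E]subn0 -sumr_const_nat -sumEFin; apply: lee_sum => i _.
  rewrite /u indicE mem_set// mule1 lee_fin -expR0 ler_expR.
  by rewrite mulrn_wge0// ltW.
rewrite integral_nneseries//; last first.
  by move=> n; apply: measurable_funeM.
apply: (@le_lt_trans _ _ (expR eps * C / (1 - q))%:E); last exact: ltry.
apply: lime_le; first by apply: is_cvg_nneseries => n _ _; apply: integral_ge0.
apply: nearW => N.
apply: (@le_trans _ _ (\sum_(0 <= n < N) (expR eps * C * q ^+ n)%:E)).
  apply: lee_sum => n _.
  rewrite /u ge0_integralZl//.
  rewrite integral_indic// setIT.
  apply: (@le_trans _ _ ((expR (eps *+ n.+1))%:E * (C * r ^+ n)%:E)).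
    rewrite lee_wpmul2l// ?lee_fin ?expR_ge0//.
    by apply: le_trans (H n); rewrite -no_return_law; exact: lexx.
  rewrite -EFinM lee_fin -mulr_natl expRM_natl /q exprMn exprS.
  by rewrite le_eqVlt; apply/orP; left; apply/eqP; ring.
rewrite sumEFin lee_fin big_mkord -mulr_sumr.
apply: ler_wpM2l; first by rewrite mulr_ge0// expR_ge0.
by apply: sum_geometric_le; rewrite q1 ltW.
Qed.

End ReturnTime.

End ChainLaw.

(** * A Markov chain with a given kernel *)

Section Realisation.
Context {R : realType} {S : countType} (P : S -> S -> R) (x : S).
Hypothesis sP : stochastic P.

Let P0 : nonneg_matrix P. Proof. by case: sP. Qed.

(** The states are listed by their codes, with weight 0 at the integers that
    code no state. *)
Definition code_weight y i : R := if pickle_inv i is Some z then P y z else 0.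
Definition code_cdf y i : R := \sum_(j < i) code_weight y j.

Let p_ge0 y i : 0 <= code_weight y i.
Proof. by rewrite /code_weight; case: pickle_inv. Qed.

Let pE y z : code_weight y (pickle z) = P y z.
Proof. by rewrite /code_weight pickleK_inv. Qed.

Let series1 y : (\sum_(i <oo) (code_weight y i)%:E = 1)%E.
Proof.
have [_ P1] := sP; rewrite -(P1 y) kop_one nneseries_esumT; last first.
  by move=> i; rewrite lee_fin.
rewrite [RHS](eq_esum (b := fun z => (code_weight y (pickle z))%:E));
  last first.
  by move=> z _; rewrite pE.
have bij : set_bij [set: S] (range (@pickle S)) pickle.
  by apply: inj_bij => u v _ _; exact: (pcan_inj pickleK).
rewrite -(@reindex_esum _ _ _ _ _ _ (fun i => (code_weight y i)%:E) bij).
rewrite [RHS]esum_mkcond; apply: eq_esum => i _; case: ifPn => //.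
rewrite notin_setE => Hi; rewrite /code_weight.
case E: (pickle_inv i) => [z|//]; exfalso; apply: Hi; exists z => //.
by have := @pickle_invK S i; rewrite E.
Qed.

Lemma code_cdfS y i : code_cdf y i.+1 = code_cdf y i + code_weight y i.
Proof. by rewrite /code_cdf big_ord_recr. Qed.

Lemma code_cdf_le y i j : (i <= j)%N -> code_cdf y i <= code_cdf y j.
Proof.
move=> ij; rewrite /code_cdf -(subnKC ij) big_split_ord /= lerDl.
exact: sumr_ge0.
Qed.

Lemma code_cdf_ge0 y i : 0 <= code_cdf y i.
Proof. exact: sumr_ge0. Qed.

Lemma code_cdf_le1 y i : code_cdf y i <= 1.
Proof.
rewrite -lee_fin -(series1 y) /code_cdf -sumEFin.
rewrite -(big_mkord xpredT (fun j => (code_weight y j)%:E)).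
by apply: nneseries_lim_ge => j _ _; rewrite lee_fin.
Qed.

Lemma code_cdf_gt y u : u < 1 -> exists i, u < code_cdf y i.
Proof.
move=> u1; apply: contrapT => H.
have : ((1 : R)%:E <= u%:E)%E.
  rewrite -(series1 y); apply: lime_le.
    by apply: is_cvg_nneseries => i _ _; rewrite lee_fin.
  apply: nearW => n; rewrite sumEFin lee_fin big_mkord leNgt.
  by apply/negP => un; apply: H; exists n.
by rewrite lee_fin leNgt u1.
Qed.

(** A word lists the states visited after time 0, latest first; its cell is a
    half-open interval whose length is the probability of that path from x.
    The cells of the one-letter extensions of w tile the cell of w. *)
Fixpoint word_mass (w : seq S) : R :=
  if w is z :: w' then word_mass w' * P (head x w') z else 1.
Fixpoint word_start (w : seq S) : R :=
  if w is z :: w' then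
    word_start w' + word_mass w' * code_cdf (head x w') (pickle z) else 0.
Definition cell w u := word_start w <= u < word_start w + word_mass w.

Lemma word_mass_ge0 w : 0 <= word_mass w.
Proof. by elim: w => [|z w IH] //=; rewrite mulr_ge0. Qed.

Lemma cell_cons z w u : cell (z :: w) u -> cell w u.
Proof.
rewrite /cell /= => /andP[lo hi]; set y := head x w in lo hi.
have m0 := word_mass_ge0 w.
apply/andP; split.
  by apply: le_trans lo; rewrite lerDl mulr_ge0// code_cdf_ge0.
apply: lt_le_trans hi _; rewrite -addrA lerD2l -mulrDr -pE -code_cdfS.
by rewrite ler_piMr// code_cdf_le1.
Qed.

Lemma cell_unit w u : cell w u -> 0 <= u < 1.
Proof.
elim: w => [|z w IH]; last by move=> /cell_cons.
by rewrite /cell /= add0r.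
Qed.

(** The rescaled position of u inside the cell of w lies in [0, 1); it falls in
    the slot of the first code whose cumulated weight exceeds it. *)
Lemma cell_split w u : cell w u -> exists z, cell (z :: w) u.
Proof.
move=> /andP[lo hi]; have m0 : 0 < word_mass w by lra.
pose v := (u - word_start w) / word_mass w.
have uv : u = word_start w + word_mass w * v.
  by rewrite mulrC divfK ?gt_eqF// addrC subrK.
have v0 : 0 <= v by rewrite divr_ge0 ?subr_ge0// ltW.
have v1 : v < 1 by rewrite ltr_pdivrMr// mul1r; lra.
have ex := code_cdf_gt (head x w) v1.
have [[|i] vi min] := ex_minnP ex.
  by move: vi; rewrite /code_cdf big_ord0 ltNge v0.
have iv : code_cdf (head x w) i <= v.
  by rewrite leNgt; apply/negP => /min; rewrite ltnn.
have : 0 < code_weight (head x w) i by move: vi; rewrite code_cdfS; lra.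
rewrite {1}/code_weight; case E: (pickle_inv i) => [z|]; last by rewrite ltxx.
have zi : pickle z = i by have := @pickle_invK S i; rewrite E.
move=> _; exists z; rewrite /cell /= zi uv lerD2l ler_pM2l// iv /=.
rewrite -addrA ltrD2l -mulrDr ltr_pM2l//.
by move: vi; rewrite code_cdfS -zi pE.
Qed.

Lemma cell_cons_inj y z w u : cell (y :: w) u -> cell (z :: w) u -> y = z.
Proof.
have lt a b : cell (a :: w) u -> cell (b :: w) u -> ~ (pickle a < pickle b)%N.
  rewrite /cell /= => /andP[_ h1] /andP[h2 _] ab.
  have : code_cdf (head x w) (pickle a).+1 <= code_cdf (head x w) (pickle b).
    exact: code_cdf_le.
  move=> /(ler_wpM2l (word_mass_ge0 w)); rewrite code_cdfS pE mulrDr; lra.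
move=> Hy Hz; apply: (pcan_inj pickleK).
by case: (ltngtP (pickle y) (pickle z)) => // /lt[].
Qed.

(** The word of length n whose cell contains u.  Outside [0, 1) there is none,
    and the default x keeps the position constant. *)
Fixpoint itinerary n (u : R) : seq S :=
  if n is m.+1 then
    xget x [set z | cell (z :: itinerary m u) u] :: itinerary m u
  else [::].
Definition position n u := head x (itinerary n u).

Lemma itinerary_cell n u : 0 <= u < 1 -> cell (itinerary n u) u.
Proof.
move=> u01; elim: n => [|n IH]; first by rewrite /cell /= add0r.
exact: (@xgetPex _ x [set z | cell (z :: itinerary n u) u] (cell_split IH)).
Qed.

Lemma itinerary_unique w u : cell w u -> itinerary (size w) u = w.
Proof.
elim: w => [|z w IH] //= H; rewrite IH; last exact: cell_cons H.
congr cons; apply: (cell_cons_inj (w := w)) (H).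
exact: (@xgetI _ x [set z | cell (z :: w) u] z).
Qed.

Lemma position_out n u : ~ (0 <= u < 1) -> position n u = x.
Proof.
move=> Hu; case: n => //= n; rewrite /position /=.
by apply: xgetPN => z /cell_unit.
Qed.

Let mu : probability _ R := uniform_prob (@ltr01 R).

Lemma uniform_itv (a b : R) : 0 <= a -> a <= b -> b <= 1 ->
  mu `[a, b[%classic = (b - a)%:E.
Proof.
move=> a0 ab b1; rewrite /mu /= /uniform_prob.
rewrite (eq_integral (cst 1%E)); last first.
  move=> u; rewrite inE /= in_itv /= => /andP[au ub].
  by rewrite /uniform_pdf (le_trans a0 au) (le_trans (ltW ub) b1) subr0 invr1.
rewrite integral_cst//= lebesgue_measure_itv /= mul1e lte_fin.
by case: ltP => // ba; congr EFin; apply/esym/eqP; rewrite subr_eq0 eq_le ba ab.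
Qed.

Lemma cellE w : [set u | cell w u] =
  `[word_start w, word_start w + word_mass w[%classic.
Proof. by apply/seteqP; split => u; rewrite /= in_itv. Qed.

Lemma word_bounds w : 0 <= word_start w /\ word_start w + word_mass w <= 1.
Proof.
elim: w => [|z w [IH0 IH1]] /=; first by rewrite add0r.
split; first by rewrite addr_ge0// mulr_ge0 ?word_mass_ge0// code_cdf_ge0.
apply: le_trans IH1; rewrite -addrA lerD2l -mulrDr -pE -code_cdfS.
by rewrite ler_piMr ?word_mass_ge0// code_cdf_le1.
Qed.

Lemma cell_mass w : mu [set u | cell w u] = (word_mass w)%:E.
Proof.
have [h0 h1] := word_bounds w.
rewrite cellE uniform_itv//; last by rewrite lerDl word_mass_ge0.
by rewrite addrC addKr.
Qed.

Let unit_itv := `[0, 1[%classic : set R.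

Lemma measurable_position n y : measurable [set u | position n u = y].
Proof.
have -> : [set u | position n u = y] =
   (\bigcup_(w : seq S) (if (size w == n) && (head x w == y) then
       [set u | cell w u] else set0))
   `|` (if x == y then ~` unit_itv else set0).
  apply/seteqP; split => u /=.
    move=> py; have [u01|u01] := boolP (0 <= u < 1).
      left; exists (itinerary n u) => //.
      have sz : size (itinerary n u) = n by elim: (n) => //= m ->.
      rewrite sz eqxx -/(position n u) py eqxx /=.
      exact: itinerary_cell.
    right; rewrite -py position_out ?eqxx; last exact/negP.
    by rewrite /unit_itv /= in_itv/=; exact/negP.
  move=> [[w _]|].
    case: ifP => // /andP[/eqP sz /eqP <-] /itinerary_unique.
    by rewrite sz /position => ->.
  case: eqP => // <-; rewrite /unit_itv /= in_itv /=.
  exact: position_out.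
apply: measurableU.
  apply: countable_bigcupT_measurable; first exact: countableP.
  by move=> w; case: ifP => // _; rewrite cellE; exact: measurable_itv.
by case: ifP => // _; apply: measurableC; exact: measurable_itv.
Qed.

Fixpoint path_word (s : nat -> S) n : seq S :=
  if n is m.+1 then s n :: path_word s m else [::].

Lemma size_path_word s n : size (path_word s n) = n.
Proof. by elim: n => //= n ->. Qed.

Lemma path_word_cell s n k u : (k <= n)%N -> cell (path_word s n) u ->
  cell (path_word s k) u.
Proof.
elim: n => [|n IH]; first by rewrite leqn0 => /eqP ->.
rewrite leq_eqVlt => /predU1P[->//|kn] /= /cell_cons; exact: IH.
Qed.

Lemma head_path_word s n : s 0%N = x -> head x (path_word s n) = s n.
Proof. by case: n. Qed.

Lemma path_eventE s n u : s 0%N = x -> 0 <= u < 1 ->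
  (forall k, (k <= n)%N -> position k u = s k) <-> cell (path_word s n) u.
Proof.
move=> s0 u01; split=> [H|H k kn].
  suff <- : itinerary n u = path_word s n by exact: itinerary_cell.
  elim: n H => //= n IH H; congr cons; first exact: (H n.+1).
  by apply: IH => k kn; apply: H; rewrite ltnW.
have /itinerary_unique := path_word_cell kn H.
by rewrite size_path_word /position => ->; exact: head_path_word.
Qed.

(** Up to the null complement of [0, 1), the event is a cell. *)
Lemma path_law s n : s 0%N = x ->
  mu [set u | forall k, (k <= n)%N -> position k u = s k] =
  (word_mass (path_word s n))%:E.
Proof.
move=> s0; set A := [set u | _].
have mA : measurable A.
  rewrite (_ : A =
    \bigcap_(k in [set k | (k <= n)%N]) [set u | position k u = s k])//.
  apply: bigcap_measurable; first by exists 0%N.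
  by move=> k _; exact: measurable_position.
have mU : measurable unit_itv by exact: measurable_itv.
have mC : measurable (~` unit_itv) by exact: measurableC.
have U1 : mu unit_itv = 1%E by rewrite uniform_itv// subr0.
have C0 : mu (~` unit_itv) = 0.
  by rewrite probability_setC// U1 subee.
rewrite -cell_mass -[A]setIT -(setUv unit_itv) setIUr measureU0.
- congr (mu _); apply/seteqP; split => u /=.
    by move=> [Au]; rewrite /unit_itv /= in_itv/= => u01; exact/path_eventE.
  move=> cu; have u01 := cell_unit cu.
  by split; [exact/path_eventE|rewrite /unit_itv /= in_itv].
- exact: measurableI.
- exact: measurableI.
- apply/eqP; rewrite eq_le measure_ge0 andbT -[leRHS]C0; apply: le_measure.
  + by rewrite inE; apply: measurableI.
  + by rewrite inE.
  + exact: subIsetr.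
Qed.

Lemma markov_chain_exists :
  exists (d : measure_display) (Omega : measurableType d)
    (mu : probability Omega R) (X : nat -> Omega -> S), markov_chain P x mu X.
Proof.
exists _, _, mu, position; split.
- exact: measurable_position.
- rewrite (_ : [set w | position 0 w = x] = setT).
    exact: probability_setT.
  by apply/seteqP; split.
move=> n s; have [s0|s0] := eqVneq (s 0%N) x.
  by rewrite !path_law// -EFinM /= head_path_word.
have empty m : [set w | forall k, (k <= m)%N -> position k w = s k] = set0.
  apply/seteqP; split => // w H; move: s0; rewrite -(H 0%N)//.
  by rewrite /position /= eqxx.
by rewrite !empty measure0 mul0e.
Qed.

End Realisation.

(** * The equivalence *)

Theorem corollary7 (R : realType) (S : countType) (P Q : S -> S -> R)
    (hP : is_probability_kernel P) (hPirr : irreducible P)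
    (hQ : is_subprobability_kernel Q)
    (hQP : forall x y, Q x y <= P x y)
    (hpos : forall x y, 0 < Q x y <-> 0 < P x y)
    (hfin : finite_set [set xy : S * S | Q xy.1 xy.2 < P xy.1 xy.2])
    (hne : [set xy : S * S | Q xy.1 xy.2 < P xy.1 xy.2] !=set0)
    (x : S) :
  strongly_positive_recurrent P <->
  (spectral_radius Q x < spectral_radius P x)%E /\ spectral_radius P x = 1%E.
Proof.
have sP : stochastic P.
  by case: hP => P0 P1; split=> // z; rewrite kop_one.
have sQ : substochastic Q.
  by case: hQ => Q0 Q1; split=> // z; rewrite kop_one.
have sP' := stochastic_sub sP.
have [[P0 _] [Q0 _]] := (sP', sQ).
have iQ : irreducible Q.
  by apply: irreducible_support hPirr => // y z /hpos.
have [[u0 v0] /= uv] := hne.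
split=> [[x0 [eps [eps0 [d [T [mu [X [cX I]]]]]]]]|[rQP rP]].
  have tail := exp_moment_decays P0 cX eps0 I.
  (* the decay of the returns of P would contradict recurrence at x0 *)
  have rP : spectral_radius P x = 1%E.
    apply/eqP; rewrite eq_le spectral_radius_le1//= leNgt; apply/negP.
    move=> /(spectral_radius_lt1 x sP' hPirr) dP.
    exact: (recurrent_not_decays sP tail) (decays_entries _ _ sP' hPirr dP).
  split=> //; rewrite rP; apply/spectral_radius_lt1 => //.
  apply: (decays_entries x x sQ iQ (x := x0)).
  exact: (perturbed_returns_decay sP sQ iQ hQP uv tail).
have dQ : decays (fun n => kpow Q n (delta x) x).
  by apply/spectral_radius_lt1 => //; rewrite -rP.
(* by irreducibility the returns to v0 decay no faster than those to x *)
have nP : ~ decays (fun n => kpow P n (delta v0) v0).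
  move=> dP; have : (spectral_radius P x < 1)%E.
    by apply/spectral_radius_lt1 => //; exact: decays_entries dP.
  by rewrite rP ltxx.
have [s sE] := (finite_seqP _).1 hfin.
have DE y z : (y, z) \notin s -> P y z - Q y z = 0.
  move=> yz; apply/eqP; rewrite subr_eq0 eq_le hQP andbT leNgt.
  apply/negP => lt; move/negP: yz; apply.
  by have : [set` s] (y, z) by rewrite -sE.
have tail : decays (no_return P v0).
  apply: no_return_decays => //.
  apply: (first_return_decays sP sQ iQ hQP uv
    (U := map fst s) (V := map snd s)).
  - move=> y z ys; apply: DE; apply: contra ys => yz.
    by apply/mapP; exists (y, z).
  - move=> y z ys; apply: DE; apply: contra ys => yz.
    by apply/mapP; exists (y, z).
  - exact: decays_entries dQ.
have [d [T [mu [X cX]]]] := markov_chain_exists v0 sP.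
have [eps eps0 I] := decays_exp_moment P0 cX tail.
by exists v0, eps; split=> //; exists d, T, mu, X.
Qed.
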